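(* Let $n\ge 3$ be an odd integer. Let $R_{n-1},R_{n-2},R_{n-3}$ be real homogeneous polynomials in $(x,y)$ of degrees $n-1,n-2,n-3$ respectively, such that $R_{n-1}(\cos\theta,\sin\theta)=1$ for all $\theta$ and $R_{n-3}(\cos\theta,\sin\theta)\le 0$ for all $\theta$. Let $$B=\int_0^{2\pi}R_{n-3}(\cos\theta,\sin\theta)\,d\theta .$$ Consider the planar system $$\dot x=-y+x\bigl(R_{n-1}(x,y)+R_{n-2}(x,y)+R_{n-3}(x,y)\bigr),$$ $$\dot y=x+y\bigl(R_{n-1}(x,y)+R_{n-2}(x,y)+R_{n-3}(x,y)\bigr).$$ (i) The origin is not a center for this system. (ii) If $B<0$, then the system has at most one limit cycle. If moreover $B$ is small enough in absolute value (that is, for given $n$ and $R_{n-2}$ there is $\delta>0$ such that this holds whenever $-\delta<B<0$), then the system has a unique limit cycle, and this limit cycle is unstable. (iii) If $B=0$, then the system does not have a limit cycle.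
   Context: In polar coordinates $x=r\cos\theta$, $y=r\sin\theta$, the system satisfies $\dot\theta=1$ and $$\frac{dr}{d\theta}=R_{n-1}(\cos\theta,\sin\theta)\,r^{n}+R_{n-2}(\cos\theta,\sin\theta)\,r^{n-1}+R_{n-3}(\cos\theta,\sin\theta)\,r^{n-2},$$ and the conditions $R_{n-1}\equiv 1$, $R_{n-3}\le 0$ refer to these functions of $\theta$. The origin is a center if all orbits in some punctured neighbourhood of the origin are periodic. A limit cycle is an isolated periodic orbit; limit cycles correspond to (isolated) positive $2\pi$-periodic solutions $r(\theta)$ of the polar equation. *)

(* Defs.v *)
From HB Require Import structures.
From mathcomp Require Import all_boot all_order all_algebra.
(* The notations of mpoly clash with those of analysis. *)
From mathcomp Require mpoly.
Import -(notations) mpoly.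
From mathcomp Require Import all_classical all_reals all_analysis.

Set Implicit Arguments.
Unset Strict Implicit.
Unset Printing Implicit Defensive.

Import Order.TTheory GRing.Theory Num.Theory.
Import numFieldNormedType.Exports.

Local Open Scope classical_set_scope.
Local Open Scope ring_scope.

(* [{mpoly R[2]}], [P \is d.-homog] (true of 0 for every d) and [P.@[_]]. *)
Definition mpoly2 (R : realType) := mpoly.mpoly 2 R.

Definition homogeneous (R : realType) (d : nat) (P : mpoly2 R) : Prop :=
  P \is mpoly.ishomog1 d (@mpoly.mdeg 2).

Definition eval2 (R : realType) (P : mpoly2 R) (x y : R) : R :=
  mpoly.meval (fun i : 'I_2 => if i == ord0 then x else y) P.

Section PlanarSystems.
Variables (R : realType) (V : R * R -> R * R).

Definition solution_on (I : set R) (g : R -> R * R) : Prop :=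
  forall t, I t -> is_derive t 1 g (V (g t)).

Definition periodic_orbit (G : set (R * R)) : Prop :=
  exists g : R -> R * R, exists T : R,
    [/\ solution_on setT g, 0 < T, forall t, g (t + T) = g t,
        exists t, g t != g 0 & G = range g].

Definition is_center (p : R * R) : Prop :=
  \forall q \near p^', exists2 G, periodic_orbit G & G q.

Definition limit_cycle (G : set (R * R)) : Prop :=
  periodic_orbit G /\
  exists2 U, set_nbhs G U &
    forall G', periodic_orbit G' -> G' `<=` U -> G' = G.

(* The usual trichotomy stable / unstable / semistable for limit cycles of
   planar systems: an unstable limit cycle is the alpha-limit set of every
   trajectory in some neighbourhood of it.  This is stronger than the failure
   of Lyapunov stability, which semistable cycles share. *)
Definition unstable_cycle (G : set (R * R)) : Prop :=
  exists2 U, set_nbhs G U &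
    forall p, U p -> exists g : R -> R * R, exists T : R,
      [/\ 0 < T, solution_on [set t | t < T] g, g 0 = p
        & cluster (g t @[t --> -oo]) = G].

End PlanarSystems.

Definition rigid_field (R : realType) (f : R -> R -> R) (p : R * R) : R * R :=
  (- p.2 + p.1 * f p.1 p.2, p.1 + p.2 * f p.1 p.2).

(* Main.v *)
(* In polar coordinates r' = r^m (r^2 + b r + a) with m = n - 2 odd, where
   b = R_{n-2} and a = R_{n-3} <= 0 are evaluated on the unit circle.  In the
   coordinate u = - r^{-m} / m the equation reads u' = r + b + a / r, which
   increases with r because a <= 0.  Hence the distance in u between two
   solutions staying in a compact subset of ]0, +oo[ decays exponentially
   backward in time: there is at most one periodic orbit, and it attracts
   backward in time.  If a = 0, then u(t) + u(t + pi) has derivative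
   r(t) + r(t + pi), since b is antiperiodic, so it is unbounded and there is no
   periodic orbit.

   If B < 0, large constants and a small periodic barrier obtained by averaging
   bound a region that is invariant backward in time and on which the backward
   Poincare map has a fixed point by the intermediate value theorem.  This needs
   no smallness of B, so [delta] can be any positive number. *)

Require Import Defs.
From HB Require Import structures.
From mathcomp Require Import all_boot all_order all_algebra.
From mathcomp Require mpoly.
Import -(notations) mpoly.
From mathcomp Require Import all_classical all_reals all_analysis.
From mathcomp Require Import lra ring.

Import Order.TTheory GRing.Theory Num.Theory.
Import numFieldNormedType.Exports.

Local Open Scope classical_set_scope.
Local Open Scope ring_scope.

(** * Real functions *)

Section Calculus.
Context {R : realType}.
Implicit Types (f g : R -> R) (x t : R).

Lemma is_derive_add f g x a b : is_derive x 1 f a -> is_derive x 1 g b ->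
  is_derive x 1 (fun t => f t + g t) (a + b).
Proof. by move=> ? ?; exact: is_deriveD. Qed.

Lemma is_derive_sub f g x a b : is_derive x 1 f a -> is_derive x 1 g b ->
  is_derive x 1 (fun t => f t - g t) (a - b).
Proof. by move=> ? ?; exact: is_deriveB. Qed.

Lemma is_derive_mul f g x a b : is_derive x 1 f a -> is_derive x 1 g b ->
  is_derive x 1 (fun t => f t * g t) (a * g x + f x * b).
Proof.
move=> df dg; apply: is_derive_eq (is_deriveM df dg) _.
by rewrite /GRing.scale/= addrC [g x * a]mulrC.
Qed.

Lemma is_derive_opp f x a : is_derive x 1 f a ->
  is_derive x 1 (fun t => - f t) (- a).
Proof. by move=> ?; exact: is_deriveN. Qed.

Lemma is_derive_const c x : is_derive x 1 (fun=> c : R) 0.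
Proof. exact: is_derive_cst. Qed.

Lemma is_derive_var x : is_derive x 1 (fun t : R => t) 1.
Proof. exact: is_derive_id. Qed.

Lemma is_derive_scale c f x a : is_derive x 1 f a ->
  is_derive x 1 (fun t => c * f t) (c * a).
Proof. by move=> ?; apply: (is_deriveZ c). Qed.

Lemma is_derive_exp f x a : is_derive x 1 f a ->
  is_derive x 1 (fun t => expR (f t)) (expR (f x) * a).
Proof. by move=> df; apply: is_derive1_comp. Qed.

Lemma is_derive_pow f k x a : is_derive x 1 f a ->
  is_derive x 1 (fun t => f t ^+ k) (k%:R * f x ^+ k.-1 * a).
Proof.
case: k => [|k] df /=.
  by rewrite !mul0r; under eq_fun do rewrite expr0; apply: is_derive_const.
have -> : (fun t => f t ^+ k.+1) = f ^+ k.+1.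
  by apply/funext => t; rewrite exprfctE.
exact: is_deriveX.
Qed.

Lemma is_derive_inv f x a : f x != 0 -> is_derive x 1 f a ->
  is_derive x 1 (fun t => (f t)^-1) (- (f x) ^- 2 * a).
Proof.
by move=> f0 df; exact: is_deriveV.
Qed.

Lemma is_derive_shiftr f c x a : is_derive (x + c) 1 f a ->
  is_derive x 1 (fun t => f (t + c)) a.
Proof.
move=> df; rewrite -[a]mulr1.
exact: is_derive1_comp (_ : is_derive (shift c x) 1 f a) (is_derive_shift _ _ _).
Qed.

Lemma is_derive_cont f x a : is_derive x 1 f a -> {for x, continuous f}.
Proof.
by case=> df _; apply: differentiable_continuous; exact/derivable1_diffP.
Qed.

Lemma is_derive_homo f f' x y : x <= y ->
  (forall t, x <= t <= y -> is_derive t 1 f (f' t)) ->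
  (forall t, x <= t <= y -> 0 <= f' t) -> f x <= f y.
Proof.
move=> xy df f'0.
have [||c] := @MVT_segment _ f f' x y xy.
- by move=> t; rewrite in_itv/= => /andP[? ?]; apply: df; rewrite !ltW.
- apply: derivable_within_continuous => t; rewrite in_itv/= => /df d.
  by case: d.
rewrite in_itv/= => /f'0 c0 E.
by rewrite -subr_ge0 E mulr_ge0 // subr_ge0.
Qed.

Lemma is_derive0_itv f x y : x <= y ->
  (forall t, x <= t <= y -> is_derive t 1 f 0) -> f x = f y.
Proof.
move=> xy df; apply/eqP; rewrite eq_le; apply/andP; split.
  by apply: (@is_derive_homo f (fun=> 0)).
rewrite -lerN2; apply: (@is_derive_homo (fun t => - f t) (fun=> - 0)) => //.
by move=> t /df; exact: is_derive_opp.
Qed.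

Lemma is_derive0_const f : (forall t, is_derive t 1 f 0) ->
  forall x y, f x = f y.
Proof. by move=> df x y; apply: (@is_derive_0_is_cst _ f x y) => t; exact: df. Qed.

Lemma continuous_within_itv f a b : continuous f -> {within `[a, b], continuous f}.
Proof. exact: continuous_subspaceT. Qed.

(* Antiderivatives on the growing intervals [-N, N], normalised to vanish at 0,
   agree by the mean value theorem and glue to a global one. *)
Lemma continuous_primitive f : continuous f ->
  exists F : R -> R, F 0 = 0 /\ forall t, is_derive t 1 F (f t).
Proof.
move=> cf.
have prim (N : R) : 0 < N -> exists F : R -> R, F 0 = 0 /\
    forall t, - N < t < N -> is_derive t 1 F (f t).
  move=> N0; pose F x := \int[lebesgue_measure]_(t in `[- N, x]) f t.
  exists (fun x => F x - F 0); split; first by rewrite subrr.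
  move=> t /andP[Nt tN]; rewrite -[f t]subr0.
  apply: is_derive_sub.
  have [|/= dF F'] := @continuous_FTC1_closed R f (- N) t N tN _ Nt (cf t).
    apply: continuous_compact_integrable; first exact: segment_compact.
    exact: continuous_within_itv.
  by apply: (DeriveDef dF); rewrite -derive1E; exact: F'.
have prim' N : exists F : R -> R, F 0 = 0 /\
    forall t, - N.+1%:R < t < N.+1%:R -> is_derive t 1 F (f t).
  exact: prim.
have [F FP] := choice prim'.
have Feq M N (t : R) : (M <= N)%N -> - M.+1%:R < t < M.+1%:R -> F M t = F N t.
  move=> MN /andP[Mt tM].
  have MN' : M.+1%:R <= N.+1%:R :> R by rewrite ler_nat.
  have [M0 dM] := FP M; have [N0 dN] := FP N.
  have dMN (s : R) : - M.+1%:R < s < M.+1%:R ->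
      is_derive s 1 (fun u => F M u - F N u) 0.
    move=> /andP[Ms sM]; rewrite -[0](subrr (f s)); apply: is_derive_sub.
      by apply: dM; rewrite Ms.
    by apply: dN; rewrite (lt_le_trans sM) // (le_lt_trans _ Ms) // lerN2.
  have M1 : 0 < M.+1%:R :> R by rewrite ltr0n.
  apply/eqP; rewrite -subr_eq0; apply/eqP.
  suff -> : F M t - F N t = F M 0 - F N 0 by rewrite M0 N0 subrr.
  have [t0|t0] := leP 0 t.
    apply/esym/(@is_derive0_itv (fun u => F M u - F N u)) => // s /andP[? ?].
    by apply/dMN/andP; split; lra.
  apply/(@is_derive0_itv (fun u => F M u - F N u)); first exact: ltW.
  by move=> s /andP[? ?]; apply/dMN/andP; split; lra.
have bnd (t : R) : `|t| < (Num.trunc `|t|).+1%:R by exact: truncnS_gt.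
exists (fun t => F (Num.trunc `|t|) t); split; first exact: (FP _).1.
(* The index is one larger than that of t: each s near t has absolute value below [N], hence a
   smaller gluing index, and [Feq] applies. *)
move=> t; set N := (Num.trunc `|t|).+1.
have tN : - N%:R < t < N%:R by rewrite -ltr_norml; exact: bnd.
have tN' : - N.+1%:R < t < N.+1%:R.
  have -> : N.+1%:R = N%:R + 1 :> R by rewrite natr1.
  by case/andP: tN => ? ?; apply/andP; split; lra.
apply: near_eq_is_derive ((FP N).2 t tN').
near=> s.
have /andP[sN Ns] : - N%:R < s < N%:R.
  have : s \in `]- N%:R, N%:R[ by near: s; apply: near_in_itvoo; rewrite in_itv.
  by rewrite in_itv.
apply/esym/Feq; last by rewrite -ltr_norml; exact: bnd.
apply/ltnW; rewrite -(ltr_nat R); apply: le_lt_trans (_ : `|s| < _).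
  by have /truncn_itv/andP[] := normr_ge0 s.
by rewrite ltr_norml; apply/andP.
Unshelve. all: by end_near. Qed.

End Calculus.

(** The primitive [S] inherits the period [T] because it agrees at 0 and [T]; being nonincreasing as
    well, it is constant. *)
Lemma le0_periodic_primitive {R : realType} (a S : R -> R) (T : R) : 0 < T ->
  (forall t, a t <= 0) -> periodic a T -> (forall t : R, is_derive t 1 S (a t)) ->
  S T = S 0 -> forall t, a t = 0.
Proof.
move=> T0 a0 aT dS ST t.
have ST' s : S (s + T) = S s.
  apply/eqP; rewrite -subr_eq0; apply/eqP.
  rewrite (@is_derive0_const _ (fun u => S (u + T) - S u) _ s 0).
    by rewrite add0r ST subrr.
  move=> u; apply: is_derive_eq (is_derive_sub _ _ _ _ _
    (is_derive_shiftr S T u _ (dS (u + T))) (dS u)) _.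
  by rewrite aT subrr.
have S_noninc x y : x <= y -> S y <= S x.
  move=> xy; rewrite -lerN2.
  apply: (@is_derive_homo _ (fun u => - S u) (fun u => - a u)) => // u _.
  by rewrite oppr_ge0.
pose h := T / 2; have h0 : 0 < h by rewrite divr_gt0.
(* The window has length [T], so monotonicity squeezes [S s] between the equal values [S (t - h)]
   and [S (t - h + T)]. *)
have Scst s : t - h < s < t + h -> S s = S (t - h).
  move=> /andP[s1 s2]; apply/eqP; rewrite eq_le S_noninc ?(ltW s1) //=.
  rewrite -[leLHS]ST' S_noninc // (le_trans (ltW s2)) // /h; lra.
have dcst : is_derive t 1 (fun=> S (t - h)) (a t).
  apply: near_eq_is_derive (dS t); near=> s; apply: Scst.
  have : s \in `]t - h, t + h[.
    by near: s; apply: near_in_itvoo; rewrite in_itv /=; apply/andP; split; lra.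
  by rewrite in_itv.
by case: dcst => _ <-; exact: derive_cst.
Unshelve. all: by end_near. Qed.

Lemma Rintegral_primitive {R : realType} (f F : R -> R) (x y : R) : x < y ->
  continuous f -> (forall t : R, is_derive t 1 F (f t)) ->
  \int[lebesgue_measure]_(t in `[x, y]) f t = F y - F x.
Proof.
move=> xy cf dF; rewrite /Rintegral (continuous_FTC2 xy (F := F)) //.
- exact: continuous_within_itv.
- have cF (t : R) : F s @[s --> t] --> F t by exact: is_derive_cont (dF t).
  split; first by move=> t _; case: (dF t).
    exact: cvg_at_right_filter.
  exact: cvg_at_left_filter.
- by move=> t _; rewrite derive1E; case: (dF t).
Qed.

(** * Differential equations with a bounded Lipschitz right-hand side *)

Section Estimates.
Context {R : realType}.
Implicit Types (f g w : R -> R) (s t x : R).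

Lemma lipschitz_continuous f K :
  (forall s t, `|f s - f t| <= K * `|s - t|) -> continuous f.
Proof.
move=> fK x.
have K0 : 0 <= K.
  by have := le_trans (normr_ge0 _) (fK 1 0); rewrite subr0 normr1 mulr1.
have K1 : 0 < K + 1 by lra.
apply/cvgrPdist_le => e e0; near=> y.
apply: le_trans (fK _ _) _.
have xy : `|x - y| <= e / (K + 1).
  by near: y; apply: (@cvgrPdist_le _ _ _ _ _ id x).1 => //; exact: divr_gt0.
have : (K + 1) * `|x - y| <= e by rewrite mulrC -ler_pdivlMr.
have := normr_ge0 (x - y); lra.
Unshelve. all: by end_near. Qed.

Lemma is_derive_lipschitz f f' (K : R) : (forall t, is_derive t 1 f (f' t)) ->
  (forall t, `|f' t| <= K) -> forall s t, `|f s - f t| <= K * `|s - t|.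
Proof.
move=> df f'K s t; wlog st : s t / s <= t.
  by move=> H; have [/H//|/ltW/H] := leP s t; rewrite distrC [`|t - s|]distrC.
rewrite distrC [`|s - t|]distrC [`|t - s|]ger0_norm ?subr_ge0 // ler_norml.
have dK (u : R) : is_derive u 1 (fun v : R => K * v) K.
  exact: is_derive_eq (is_derive_scale K _ _ _ (is_derive_var u)) (mulr1 K).
apply/andP; split.
  have : K * s + f s <= K * t + f t.
    apply: (@is_derive_homo _ (fun v => K * v + f v) (fun v => K + f' v)) => // u _.
    by have := f'K u; rewrite ler_norml => /andP[]; lra.
  lra.
have : K * s - f s <= K * t - f t.
  apply: (@is_derive_homo _ (fun v => K * v - f v) (fun v => K - f' v)) => // u _.
  by have := f'K u; rewrite ler_norml => /andP[]; lra.
lra.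
Qed.

(** Squares avoid differentiating an absolute value: [w ^+ 2] times exp(-2Lt) is nonincreasing and
    times exp(2Lt) is nondecreasing, one for each direction of time. *)
Lemma gronwall w w' L : (forall t, is_derive t 1 w (w' t)) ->
  (forall t, `|w' t| <= L * `|w t|) ->
  forall s t, w t ^+ 2 <= w s ^+ 2 * expR (2 * L * `|t - s|).
Proof.
move=> dw w'L s t.
have ww' (u : R) : `|w u * w' u| <= L * w u ^+ 2.
  rewrite normrM -normr_id -[w u ^+ 2]ger0_norm ?sqr_ge0 // normrX normr_id.
  by rewrite mulrC expr2 mulrA ler_wpM2r.
have dE (c u : R) : is_derive u 1 (fun v => w v ^+ 2 * expR (c * v))
    ((2 * (w u * w' u) + c * w u ^+ 2) * expR (c * u)).
  apply: is_derive_eq (is_derive_mul _ _ _ _ _ (is_derive_pow _ 2 _ _ (dw u))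
   (is_derive_exp _ _ _ (is_derive_scale c _ _ _ (is_derive_var u)))) _.
  by rewrite /=; ring.
have [st|ts] := leP s t.
  rewrite ger0_norm ?subr_ge0 //.
  have : - (w s ^+ 2 * expR (- (2 * L) * s)) <= - (w t ^+ 2 * expR (- (2 * L) * t)).
    apply: (@is_derive_homo _ (fun v => - (w v ^+ 2 * expR (- (2 * L) * v)))) => //.
    move=> u _; rewrite /= -mulNr mulr_ge0 ?expR_ge0 //.
    by have := ww' u; rewrite ler_norml => /andP[]; lra.
  rewrite lerN2 -(ler_pM2r (expR_gt0 (2 * L * t))) -![_ ^+ 2 * _ * _]mulrA -!expRD.
  rewrite mulNr addNr expR0 mulr1; congr (_ <= _ * expR _); ring.
rewrite ltr0_norm ?subr_lt0 //.
have : w t ^+ 2 * expR (2 * L * t) <= w s ^+ 2 * expR (2 * L * s).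
  apply: (@is_derive_homo _ (fun v => w v ^+ 2 * expR (2 * L * v))) => //.
  - exact: ltW.
  - move=> u _; rewrite /= mulr_ge0 ?expR_ge0 //.
    by have := ww' u; rewrite ler_norml => /andP[]; lra.
rewrite -(ler_pM2r (expR_gt0 (- (2 * L * t)))) -![_ ^+ 2 * _ * _]mulrA -!expRD.
rewrite subrr expR0 mulr1; congr (_ <= _ * expR _); ring.
Qed.

(** With the weight exp(2L|t|), integrating a function of size LC gives one of size C/2. This makes
    the Picard operator a contraction by 1/2 on the whole line. *)
Lemma primitive_le f f' L C : 0 <= C ->
  f 0 = 0 -> (forall t, is_derive t 1 f (f' t)) ->
  (forall t, `|f' t| <= L * C * expR (2 * L * `|t|)) ->
  forall t, `|f t| <= C / 2 * expR (2 * L * `|t|).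
Proof.
move=> C0 f0 df f'L.
(* An upper bound for nonnegative times; the other cases follow by negating the function or
   reversing time. *)
have aux g g' : g 0 = 0 -> (forall t, is_derive t 1 g (g' t)) ->
    (forall t, g' t <= L * C * expR (2 * L * `|t|)) ->
    forall t, 0 <= t -> g t <= C / 2 * expR (2 * L * t).
  move=> g0 dg g'L t t0.
  have : C / 2 * expR (2 * L * 0) - g 0 <= C / 2 * expR (2 * L * t) - g t.
    apply: (@is_derive_homo _ (fun v => C / 2 * expR (2 * L * v) - g v)
      (fun v => C / 2 * (expR (2 * L * v) * (2 * L * 1)) - g' v)) => // u /andP[u0 _].
    by have := g'L u; rewrite ger0_norm //; lra.
  by rewrite g0 mulr0 expR0; lra.
have bnd (u : R) : - (L * C * expR (2 * L * `|u|)) <= f' u <= L * C * expR (2 * L * `|u|).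
  by rewrite -ler_norml.
have df_opp (u : R) : is_derive u 1 (fun v => f (- v)) (- f' (- u)).
  apply: is_derive_eq (is_derive1_comp (df (- u)) (is_derive_opp _ _ _ (is_derive_var u))) _.
  by rewrite mulrN1.
move=> t; have [t0|t0] := leP 0 t.
  rewrite [`|t|]ger0_norm // ler_norml; apply/andP; split; last first.
    by apply: (aux f f') => // u; have /andP[] := bnd u.
  rewrite lerNl; apply: (aux (fun v => - f v) (fun v => - f' v)) => //.
  - by rewrite f0 oppr0.
  - by move=> u; have /andP[] := bnd u; lra.
rewrite [`|t|]ltr0_norm // ler_norml -[t in f t]opprK.
have t0' : 0 <= - t by lra.
apply/andP; split; last first.
  apply: (aux (fun v => f (- v)) (fun v => - f' (- v))) => //.
  - by rewrite oppr0.
  - by move=> u; have /andP[] := bnd (- u); rewrite normrN; lra.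
rewrite lerNl; apply: (aux (fun v => - f (- v)) (fun v => - - f' (- v))) => //.
- by rewrite oppr0 f0 oppr0.
- by move=> u; have /andP[] := bnd (- u); rewrite normrN; lra.
Qed.

Lemma le_geometric (a b c : R) : (forall k : nat, a <= b + c / 2 ^+ k) -> a <= b.
Proof.
move=> H; have [//|ba] := leP a b.
have ab : 0 < a - b by rewrite subr_gt0.
pose k := Num.bound (c / (a - b)).
have : c / (a - b) < 2 ^+ k by apply: upper_nthrootP.
have := H k; rewrite -lerBlDl ler_pdivlMr ?exprn_gt0 // ltr_pdivrMr //.
rewrite mulrC; lra.
Qed.

(** The intervals of radius 2A/2^k around [u k] are nested; the limit is the supremum of their left
    endpoints. *)
Lemma geometric_limit (u : nat -> R) A : 
  (forall k, `|u k.+1 - u k| <= A / 2 ^+ k) ->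
  exists l, forall k, `|u k - l| <= 2 * A / 2 ^+ k.
Proof.
move=> uA.
have A0 : 0 <= A by have := le_trans (normr_ge0 _) (uA 0); rewrite expr0 divr1.
pose a k := u k - 2 * A / 2 ^+ k; pose b k := u k + 2 * A / 2 ^+ k.
have step k : 2 * A / 2 ^+ k.+1 = A / 2 ^+ k.
  by rewrite exprS; field; exact: expf_neq0.
have stepa k : a k <= a k.+1.
  rewrite /a step; have := uA k; rewrite ler_norml => /andP[+ _].
  by rewrite -[2 * A / _]mulrA; lra.
have stepb k : b k.+1 <= b k.
  rewrite /b step; have := uA k; rewrite ler_norml => /andP[_].
  by rewrite -[2 * A / _]mulrA; lra.
have ha := homo_leq (@lexx _ R) (@le_trans _ R) stepa.
have hb := homo_leq (r := fun x y : R => y <= x) (@lexx _ R)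
  (fun y x z xy yz => le_trans yz xy) stepb.
have ab i j : a i <= b j.
  apply: le_trans (ha _ _ (leq_maxl i j)) (le_trans _ (hb _ _ (leq_maxr i j))).
  have : 0 <= A / 2 ^+ maxn i j by rewrite divr_ge0 // exprn_ge0.
  by rewrite /a /b -[2 * A / _]mulrA; lra.
have hs : has_sup (range a).
  by split; [exists (a 0), 0|exists (b 0) => _ [k _ <-]].
exists (sup (range a)) => k; rewrite ler_distl.
have : a k <= sup (range a) by apply: sup_upper_bound => //; exists k.
have : sup (range a) <= b k by apply: ge_sup; [exact: hs.1|move=> _ [j _ <-]].
by rewrite /a /b => ? ?; apply/andP; split; lra.
Qed.

End Estimates.

(** * Global solutions by Picard iteration *)

Section Picard.
Context {R : realType}.
Implicit Types (s t u : R) (x y : R -> R).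
Variables (h : R -> R -> R) (K L : R).
Hypothesis L_gt0 : 0 < L.
Hypothesis h_bounded : forall t (x : R), `|h t x| <= K.
Hypothesis h_lipschitz : forall t (x y : R), `|h t x - h t y| <= L * `|x - y|.
Hypothesis h_continuous : forall x : R -> R, continuous x ->
  continuous (fun t => h t (x t)).

(** Successive iterates starting from the constant [x0] differ by a geometric sequence in the
    weighted norm. The bound [K] starts this estimate and also makes the limit Lipschitz. *)
Lemma ode_exists0 (x0 : R) : exists x : R -> R,
  x 0 = x0 /\ forall t, is_derive t 1 x (h t (x t)).
Proof.
(* The condition is void for discontinuous [f], where [f] itself is a dummy witness; choice then
   yields an operator [P] on all functions. *)
have prim (f : R -> R) : exists F : R -> R, continuous f ->
    F 0 = x0 /\ forall t, is_derive t 1 F (f t).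
  have [cf|//] := pselect (continuous f); last by exists f.
  have [F [F0 dF]] := continuous_primitive f cf.
  exists (fun t => F t + x0) => _; split; first by rewrite F0 add0r.
  by move=> t; rewrite -[f t]addr0; apply: is_derive_add => //; apply: is_derive_const.
have [P PP] := choice prim.
pose T x := P (fun t => h t (x t)).
have TP x : continuous x -> T x 0 = x0 /\ forall t, is_derive t 1 (T x) (h t (x t)).
  by move=> cx; apply: PP; exact: h_continuous.
have cT x : continuous x -> continuous (T x).
  by move=> /TP[_ dT] t; exact: is_derive_cont (dT t).
have contr x y C : 0 <= C -> continuous x -> continuous y ->
    (forall t, `|x t - y t| <= C * expR (2 * L * `|t|)) ->
    forall t, `|T x t - T y t| <= C / 2 * expR (2 * L * `|t|).
  move=> C0 cx cy xy; have [x0E dx] := TP x cx; have [y0E dy] := TP y cy.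
  apply: (@primitive_le _ (fun t => T x t - T y t)
    (fun t => h t (x t) - h t (y t))) => //.
  - by rewrite x0E y0E subrr.
  - move=> t; apply: le_trans (h_lipschitz _ _ _) _.
    by rewrite -mulrA ler_wpM2l // ltW.
pose xs k := iter k T (fun=> x0).
have cxs k : continuous (xs k).
  elim: k => [|k IH]; last exact: cT.
  by move=> t; exact: cvg_cst.
have K0 : 0 <= K := le_trans (normr_ge0 _) (h_bounded 0 0).
(* Chosen so that [L * C = K]: the bound on [h] then controls the first increment. *)
pose C := K / L.
have C0 : 0 <= C by rewrite divr_ge0 // ltW.
have expR1 t : 1 <= expR (2 * L * `|t|).
  by rewrite -expR0 ler_expR !mulr_ge0 // ltW.
have step k t : `|xs k.+1 t - xs k t| <= C / 2 ^+ k * expR (2 * L * `|t|).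
  elim: k t => [|k IH] t.
    rewrite expr0 divr1 /=.
    have [T0 dT] := TP _ (cxs 0).
    apply: le_trans (_ : C / 2 * expR (2 * L * `|t|) <= _); last first.
      by rewrite ler_wpM2r ?expR_ge0 //; lra.
    apply: (@primitive_le _ (fun t => xs 1 t - x0) (fun t => h t (xs 0 t) - 0)) => //.
    - by rewrite /xs /= T0 subrr.
    - move=> u; rewrite subr0; apply: le_trans (h_bounded _ _) _.
      have -> : L * C = K by rewrite /C mulrC divfK // gt_eqF.
      by rewrite ler_peMr.
  have -> : C / 2 ^+ k.+1 = C / 2 ^+ k / 2 by rewrite exprS; field; exact: expf_neq0.
  apply: (contr (xs k.+1) (xs k)) ; [|exact: cxs k.+1|exact: cxs|exact: IH].
  by rewrite divr_ge0 // exprn_ge0.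
have xs_cvg (t : R) : exists l, forall k, `|xs k t - l| <= 2 * (C * expR (2 * L * `|t|)) / 2 ^+ k.
  apply: geometric_limit => k; apply: le_trans (step k t) _.
  by rewrite mulrAC.
have [x xP] := choice xs_cvg.
(* The iterates have derivatives bounded by [K], so they are [K]-Lipschitz, and this passes to the
   pointwise limit. *)
have cx : continuous x.
  apply: (@lipschitz_continuous _ _ K) => s t.
  have half u k : 2 * (C * expR (2 * L * `|u|)) / 2 ^+ k.+1 = C * expR (2 * L * `|u|) / 2 ^+ k.
    by rewrite exprS; field; exact: expf_neq0.
  apply: (@le_geometric _ _ _ (C * expR (2 * L * `|s|) + C * expR (2 * L * `|t|))) => k.
  have := is_derive_lipschitz _ _ _ (TP _ (cxs k)).2 (fun u => h_bounded u _) s t.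
  rewrite -[T (xs k)]/(xs k.+1) mulrDl.
  have := xP s k.+1; have := xP t k.+1; rewrite !half.
  rewrite (distrC (xs k.+1 s)).
  have -> : x s - x t = (x s - xs k.+1 s) + (xs k.+1 s - xs k.+1 t) + (xs k.+1 t - x t) by ring.
  have := ler_normD (x s - xs k.+1 s + (xs k.+1 s - xs k.+1 t)) (xs k.+1 t - x t).
  have := ler_normD (x s - xs k.+1 s) (xs k.+1 s - xs k.+1 t).
  lra.
(* By contraction [T x] is within O(2^-k) of [T (xs k)], the next iterate, which is equally close to
   [x]. *)
exists x; suff xE : T x = x by have := TP x cx; rewrite xE.
apply/funext => t; apply/eqP; rewrite -subr_eq0 -normr_le0.
apply: (@le_geometric _ _ _ (2 * C * expR (2 * L * `|t|))) => k; rewrite add0r.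
have xk s : `|x s - xs k s| <= 2 * C / 2 ^+ k * expR (2 * L * `|s|).
  by rewrite distrC; apply: le_trans (xP s k) _; rewrite le_eqVlt; apply/orP; left; apply/eqP; ring.
have := contr x (xs k) _ _ cx (cxs k) xk t.
have -> : 2 * C / 2 ^+ k / 2 = C / 2 ^+ k by field; exact: expf_neq0.
have /[swap] /[apply] : 0 <= 2 * C / 2 ^+ k by rewrite divr_ge0 ?exprn_ge0 // mulr_ge0.
have := xP t k.+1.
have -> : 2 * (C * expR (2 * L * `|t|)) / 2 ^+ k.+1 = C / 2 ^+ k * expR (2 * L * `|t|).
  by rewrite exprS; field; exact: expf_neq0.
have -> : T x t - x t = (T x t - xs k.+1 t) + (xs k.+1 t - x t) by ring.
have := ler_normD (T x t - xs k.+1 t) (xs k.+1 t - x t).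
have -> : 2 * C * expR (2 * L * `|t|) / 2 ^+ k = 2 * (C / 2 ^+ k * expR (2 * L * `|t|)) by ring.
rewrite -/(xs k.+1); rewrite /xs /=; lra.
Qed.

End Picard.

(** * Arbitrary initial times, periodic functions, barriers and differences of powers *)

Section Tools.
Context {R : realType}.
Implicit Types (f g d : R -> R) (s t x y T : R).

Lemma ode_exists (h : R -> R -> R) (K L : R) : 0 < L ->
  (forall t x, `|h t x| <= K) ->
  (forall t x y, `|h t x - h t y| <= L * `|x - y|) ->
  (forall f, continuous f -> continuous (fun t => h t (f t))) ->
  forall t0 x0, exists f, f t0 = x0 /\ forall t, is_derive t 1 f (h t (f t)).
Proof.
move=> L0 hK hL hc t0 x0.
have hc' f : continuous f -> continuous (fun t => h (t + t0) (f t)).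
  move=> cf; pose g s := f (s - t0).
  have cg : continuous g.
    move=> s; apply: (@continuous_comp _ _ _ (fun s => s - t0) f); last exact: cf.
    by apply: cvgB; [exact: cvg_id|exact: cvg_cst].
  have -> : (fun t => h (t + t0) (f t)) = (fun t => h t (g t)) \o (fun t => t + t0).
    by apply/funext => t /=; rewrite /g addrK.
  move=> s; apply: continuous_comp; last exact: hc.
  by apply: cvgD; [exact: cvg_id|exact: cvg_cst].
have [y [y0 dy]] := @ode_exists0 _ (fun t => h (t + t0)) K L L0
  (fun t => hK (t + t0)) (fun t => hL (t + t0)) hc' x0.
exists (fun t => y (t - t0)); split; first by rewrite subrr.
move=> t; have := is_derive_shiftr y (- t0) t _ (dy (t - t0)).
by rewrite subrK.
Qed.

Lemma periodicz {V : zmodType} (f : R -> V) T : periodic f T ->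
  forall (k : int) x, f (x + T *~ k) = f x.
Proof.
move=> fT [k|k] x; first by rewrite -pmulrn periodicn.
by rewrite NegzE mulrNz -pmulrn -[LHS](periodicn fT k.+1) subrK.
Qed.

Lemma periodic_reduce T x : 0 < T -> exists k : int, 0 <= x - T *~ k <= T.
Proof.
move=> T0; exists (Num.floor (x / T)).
have /andP[] := floor_itv (x / T).
rewrite ler_pdivlMr // ltr_pdivrMr // intrD mulrDl mul1r.
rewrite -mulrzl => ? ?; apply/andP; split; lra.
Qed.

Lemma periodic_bounded f T : continuous f -> 0 < T -> periodic f T ->
  exists C, forall t, `|f t| <= C.
Proof.
move=> cf T0 fT.
have cn : {within `[0, T], continuous (fun t => `|f t|)}.
  apply: continuous_subspaceT => x; apply: continuous_comp; first exact: cf.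
  exact: norm_continuous.
have [c _ cmax] := EVT_max (ltW T0) cn.
exists `|f c| => t; have [k kt] := periodic_reduce T t T0.
by rewrite -(subrK (T *~ k) t) periodicz //; apply: cmax; rewrite in_itv.
Qed.

(** A negative minimum of [d] over [[t, t0]] is not attained at [t0], and there the negative
    derivative makes [d] still smaller just to the right. *)
Lemma barrier d d' t0 : (forall t, is_derive t 1 d (d' t)) -> 0 <= d t0 ->
  (forall t, t <= t0 -> d t < 0 -> d' t < 0) -> forall t, t <= t0 -> 0 <= d t.
Proof.
move=> dd d0 dneg t tt0; rewrite leNgt; apply/negP => dt.
have cd : continuous d by move=> s; exact: is_derive_cont (dd s).
have [c] := EVT_min tt0 (continuous_within_itv _ _ _ cd).
rewrite in_itv/= => /andP[tc ct0] cmin.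
have dc : d c < 0 by apply: le_lt_trans dt; apply: cmin; rewrite in_itv/= lexx.
have ct : c < t0.
  by rewrite lt_neqAle ct0 andbT; apply: contraTneq d0 => <-; rewrite -ltNge.
have [g [dg cg gc]] := (is_derive1_caratheodory d c (d' c)).1 (dd c).
have gneg : \forall z \near c, g z < 0.
  by apply: (@cvgr_lt _ _ _ _ g (g c) cg); rewrite gc; exact: dneg.
have gneg' : \forall z \near c^'+, g z < 0.
  by apply: filterS gneg => z gz _.
near c^'+ => z.
have cz : c < z by near: z; exact: nbhs_right_gt.
have zt : z <= t0 by near: z; exact: nbhs_right_le.
have gz : g z < 0 by near: z; exact: gneg'.
have : d c <= d z by apply: cmin; rewrite in_itv/= zt (le_trans tc (ltW cz)).
by rewrite -subr_ge0 dg nmulr_rge0 // subr_le0 leNgt cz.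
Unshelve. all: by end_near. Qed.

(** An algebraic mean value estimate: [S] is the sum of the mixed monomials of degree [k], each
    lying between [c ^+ k] and [C ^+ k]. *)
Lemma subX_bounds (c C x y : R) k : 0 <= c -> c <= x <= C -> c <= y <= C ->
  exists S, x ^+ k.+1 - y ^+ k.+1 = (x - y) * S /\
    k.+1%:R * c ^+ k <= S <= k.+1%:R * C ^+ k.
Proof.
move=> c0 /andP[cx xC] /andP[cy yC].
exists (\sum_(i < k.+1) x ^+ (k - i) * y ^+ i); split.
  by rewrite subrXX; congr (_ * _); apply: eq_bigr => i _; rewrite subSS.
have sumc (e : R) : k.+1%:R * e ^+ k = \sum_(i < k.+1) e ^+ (k - i) * e ^+ i.
  rewrite (eq_bigr (fun=> e ^+ k)) => [|i _]; last first.
    by rewrite -exprD subnK // -ltnS.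
  by rewrite sumr_const card_ord mulr_natl.
have x0 := le_trans c0 cx; have y0 := le_trans c0 cy.
have C0 := le_trans x0 xC.
rewrite !sumc; apply/andP; split; apply: ler_sum => i _;
  by apply: ler_pM; rewrite ?exprn_ge0 // lerXn2r.
Qed.

End Tools.

(** * The scalar polar equation *)

Section ScalarEquation.
Context {R : realType}.
Implicit Types (r : R -> R) (s t x y c C M : R).
Variables (k : nat) (a b : R -> R).
Hypothesis a_cont : continuous a.
Hypothesis b_cont : continuous b.
Hypothesis a_le0 : forall t, a t <= 0.
Hypothesis a_pi : periodic a pi.
Hypothesis b_pi : alternating b pi.

(** Here [k] stands for n - 3, so [k.+1] is the exponent m = n - 2. *)
Definition polar_field t x : R := x ^+ k.+1 * (x ^+ 2 + b t * x + a t).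

Local Notation F := polar_field.

(* [x ^- k.+1] is a coordinate in which the velocity is monotone in [x]. *)
Lemma is_derive_invX r t : 0 < r t -> is_derive t 1 r (F t (r t)) ->
  is_derive t 1 (fun s => (r s ^+ k.+1)^-1)
    (- k.+1%:R * (r t + b t + a t / r t)).
Proof.
move=> rt dr; have rt0 : r t != 0 by rewrite gt_eqF.
apply: is_derive_eq (is_derive_inv _ _ _ _ (is_derive_pow _ k.+1 _ _ dr)) _.
  by rewrite expf_neq0.
have y0 : r t ^+ k != 0 by rewrite expf_neq0.
rewrite /F [r t ^+ k.+1]exprS /=.
by move: (r t ^+ k) (k.+1%:R : R) y0 => y l y0; field; rewrite rt0.
Qed.

(** The constants depend only on [c] and [C]. The difference [w] of the two inverse powers satisfies
    [w * w' >= gam * w ^+ 2], so it decays backward in time; the factor relating [w] to the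
    difference of the radii is bounded on [[c, C]]. *)
Lemma polar_contraction c C : 0 < c -> exists D gam, 0 < gam /\
  forall r1 r2 t0,
    (forall t, t <= t0 -> c <= r1 t <= C /\ is_derive t 1 r1 (F t (r1 t))) ->
    (forall t, t <= t0 -> c <= r2 t <= C /\ is_derive t 1 r2 (F t (r2 t))) ->
    forall s t, s <= t -> t <= t0 ->
      `|r2 s - r1 s| <= D * expR (- (gam * (t - s))).
Proof.
move=> c0; have [cC|Cc] := leP c C; last first.
  (* If [C < c], no radius satisfies the bounds, and the constants are dummies. *)
  exists 0, 1; split=> // r1 r2 t0 H _ s t st tt0; exfalso.
  by have [/andP[/le_trans/[apply]]] := H t tt0; rewrite leNgt Cc.
have C0 := lt_le_trans c0 cC.
pose p := k.+1.
have p0 : 0 < p%:R :> R by rewrite ltr0n.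
have ck0 j : 0 < c ^+ j by exact: exprn_gt0.
have Ck0 j : 0 < C ^+ j by exact: exprn_gt0.
pose gam := (c ^+ p * c ^+ p) / C ^+ k.
have gam0 : 0 < gam by rewrite divr_gt0 // mulr_gt0.
pose E := (C ^+ p * C ^+ p) / (p%:R * c ^+ k).
exists ((c ^+ p)^-1 * E), gam; split=> // r1 r2 t0 H1 H2 s t st tt0.
pose w u := (r1 u ^+ p)^-1 - (r2 u ^+ p)^-1.
pose w' u := p%:R * (r2 u - r1 u) * (1 - a u / (r1 u * r2 u)).
have dw u : u <= t0 -> is_derive u 1 w (w' u).
  move=> ut; have [/andP[c1 _] d1] := H1 u ut; have [/andP[c2 _] d2] := H2 u ut.
  have r1p : 0 < r1 u by apply: lt_le_trans c1.
  have r2p : 0 < r2 u by apply: lt_le_trans c2.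
  apply: is_derive_eq (is_derive_sub _ _ _ _ _
    (is_derive_invX _ _ r1p d1) (is_derive_invX _ _ r2p d2)) _.
  by rewrite /w' /p; field; rewrite !gt_eqF.
(* [G] is the ratio of [r2 - r1] to [w]; the bounds of [subX_bounds] on [S] give [G <= E] and
   [gam <= p%:R * G]. *)
have key u : u <= t0 -> exists G, [/\ r2 u - r1 u = w u * G, G <= E, 0 < G & gam <= p%:R * G].
  move=> ut; have [/andP[c1 C1] _] := H1 u ut; have [/andP[c2 C2] _] := H2 u ut.
  have r1p : 0 < r1 u by apply: lt_le_trans c1.
  have r2p : 0 < r2 u by apply: lt_le_trans c2.
  have [||S [SE /andP[S1 S2]]] := @subX_bounds _ c C (r2 u) (r1 u) k (ltW c0).
    by rewrite c2.
    by rewrite c1.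
  have Sp : 0 < S by apply: lt_le_trans S1; exact: mulr_gt0.
  have r1X : 0 < r1 u ^+ p by exact: exprn_gt0.
  have r2X : 0 < r2 u ^+ p by exact: exprn_gt0.
  exists (r1 u ^+ p * r2 u ^+ p / S); split.
  - have -> : w u = (r2 u ^+ p - r1 u ^+ p) / (r1 u ^+ p * r2 u ^+ p).
      by rewrite /w; field; rewrite !gt_eqF.
    by rewrite SE; field; rewrite !gt_eqF.
  - rewrite ler_pdivrMr // /E mulrAC ler_pdivlMr ?mulr_gt0 //.
    apply: (@ler_pM _ (r1 u ^+ p * r2 u ^+ p) (C ^+ p * C ^+ p) (p%:R * c ^+ k) S);
      rewrite ?mulr_ge0 ?(ltW r1X) ?(ltW r2X) ?(ltW p0) ?(ltW (ck0 k)) //.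
    by apply: ler_pM; rewrite ?(ltW r1X) ?(ltW r2X) // lerXn2r // nnegrE ltW.
  - by rewrite divr_gt0 // mulr_gt0.
  - rewrite /gam mulrA ler_pdivlMr // mulrAC ler_pdivrMr //.
    have -> : p%:R * (r1 u ^+ p * r2 u ^+ p) * C ^+ k = (r1 u ^+ p * r2 u ^+ p) * (p%:R * C ^+ k).
      by ring.
    apply: (@ler_pM _ (c ^+ p * c ^+ p) (r1 u ^+ p * r2 u ^+ p) S (p%:R * C ^+ k));
      rewrite ?mulr_ge0 ?(ltW (ck0 p)) ?(ltW Sp) //.
    by apply: ler_pM; rewrite ?(ltW (ck0 p)) // lerXn2r // nnegrE ltW.
have mono : w s ^+ 2 * expR (- (2 * gam) * s) <= w t ^+ 2 * expR (- (2 * gam) * t).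
  apply: (@is_derive_homo _ (fun u => w u ^+ 2 * expR (- (2 * gam) * u))
    (fun u => 2 * (w u * w' u - gam * w u ^+ 2) * expR (- (2 * gam) * u))) => // u /andP[su ut].
    have ut0 := le_trans ut tt0.
    apply: is_derive_eq (is_derive_mul _ _ _ _ _ (is_derive_pow _ 2 _ _ (dw u ut0))
      (is_derive_exp _ _ _ (is_derive_scale (- (2 * gam)) _ _ _ (is_derive_var u)))) _.
    by rewrite /=; ring.
  have ut0 := le_trans ut tt0.
  have [G [rG _ G0 gG]] := key u ut0.
  rewrite mulr_ge0 ?expR_ge0 // mulr_ge0 // subr_ge0.
  rewrite /w' rG; have [/andP[c1 C1] _] := H1 u ut0; have [/andP[c2 C2] _] := H2 u ut0.
  have : 0 <= - (a u / (r1 u * r2 u)).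
    by rewrite -mulNr divr_ge0 ?oppr_ge0 // mulr_ge0 // (le_trans (ltW c0)).
  set z := a u / (r1 u * r2 u) => z0.
  have -> : w u * (p%:R * (w u * G) * (1 - z)) = (p%:R * G) * (1 - z) * w u ^+ 2 by ring.
  rewrite ler_wpM2r ?sqr_ge0 //; apply: le_trans gG _.
  by rewrite ler_peMr ?mulr_ge0 ?(ltW G0) //; lra.
(* Both inverse powers lie between 0 and [(c ^+ p)^-1], which bounds their difference independently
   of the solutions. *)
have wt : `|w t| <= (c ^+ p)^-1.
  have [/andP[c1 C1] _] := H1 t tt0; have [/andP[c2 C2] _] := H2 t tt0.
  have inv x : c <= x -> 0 <= (x ^+ p)^-1 <= (c ^+ p)^-1.
    move=> cr; have r0 := lt_le_trans c0 cr.
    rewrite invr_ge0 exprn_ge0 ?(ltW r0) //= lef_pV2 ?posrE ?exprn_gt0 //.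
    by rewrite lerXn2r // nnegrE ltW.
  have /andP[? ?] := inv _ c1; have /andP[? ?] := inv _ c2.
  by rewrite /w ler_norml; apply/andP; split; lra.
have [G [-> GE G0 _]] := key s (le_trans st tt0).
rewrite normrM (ger0_norm (ltW G0)) -mulrA [E * _]mulrC mulrA.
apply: ler_pM => //; first exact: ltW.
have e0 : 0 <= (c ^+ p)^-1 * expR (- (gam * (t - s))).
  by rewrite mulr_ge0 ?expR_ge0 // invr_ge0 (ltW (ck0 p)).
rewrite -(@ler_pXn2r _ 2) ?nnegrE // real_normK ?num_real // exprMn.
rewrite [expR _ ^+ 2]expr2 -expRD.
have fin (X Y g u v : R) : X * expR (- (2 * g) * u) <= Y * expR (- (2 * g) * v) ->
    X <= Y * expR (- (2 * g) * v + 2 * g * u).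
  rewrite -(ler_pM2r (expR_gt0 (2 * g * u))) -![_ * expR _ * _]mulrA -!expRD.
  by rewrite [- _ * u]mulNr addNr expR0 mulr1.
apply: le_trans (fin _ _ _ _ _ mono) _.
have -> : - (2 * gam) * t + 2 * gam * s = - (gam * (t - s)) - gam * (t - s) by ring.
rewrite ler_wpM2r ?expR_ge0 // -[leLHS](@real_normK _ (w t)) ?num_real //.
by rewrite lerXn2r // nnegrE ?invr_ge0 ?(ltW (ck0 p)).
Qed.

(** In the sum v(t) + v(t + pi) the alternating [b] cancels, and what remains grows at rate at least
    2c, although [v] is bounded. *)
Lemma no_bounded_solution r c C : 0 < c ->
  (forall t, c <= r t <= C) -> (forall t, is_derive t 1 r (F t (r t))) ->
  (forall t, a t = 0) -> False.
Proof.
move=> c0 rb dr a0.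
have rp t : 0 < r t by have /andP[+ _] := rb t; exact: lt_le_trans.
pose v t := - (r t ^+ k.+1)^-1.
have vb t : - (c ^+ k.+1)^-1 <= v t <= 0.
  rewrite /v lerN2 oppr_le0 invr_ge0 exprn_ge0 ?(ltW (rp t)) // andbT.
  rewrite lef_pV2 ?posrE ?exprn_gt0 // lerXn2r // ?nnegrE ?(ltW c0) ?(ltW (rp t)) //.
  by have /andP[] := rb t.
have dv t : is_derive t 1 v (k.+1%:R * (r t + b t)).
  apply: is_derive_eq (is_derive_opp _ _ _ (is_derive_invX _ _ (rp t) (dr t))) _.
  by rewrite a0 mul0r addr0 mulNr opprK.
(* After time [T] the growth 2cT is [2 * (c ^+ k.+1)^-1 + 2], more than the range of the sum
   allows. *)
pose T := ((c ^+ k.+1)^-1 + 1) / c.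
have T0 : 0 <= T by rewrite divr_ge0 ?addr_ge0 ?invr_ge0 ?exprn_ge0 ?(ltW c0).
have : v 0 + v (0 + pi) - 2 * c * 0 <= v T + v (T + pi) - 2 * c * T.
  apply: (@is_derive_homo _ (fun t => v t + v (t + pi) - 2 * c * t)
   (fun t => k.+1%:R * (r t + b t) + k.+1%:R * (r (t + pi) + b (t + pi)) - 2 * c * 1)) => //.
    move=> t _; exact: is_derive_sub (is_derive_add _ _ _ _ _ (dv t)
      (is_derive_shiftr v pi t _ (dv (t + pi)))) (is_derive_scale (2 * c) _ _ _ (is_derive_var t)).
  move=> t _; rewrite b_pi mulr1.
  have -> : k.+1%:R * (r t + b t) + k.+1%:R * (r (t + pi) - b t) =
    k.+1%:R * (r t + r (t + pi)) by ring.
  have /andP[r1 _] := rb t; have /andP[r2 _] := rb (t + pi).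
  rewrite subr_ge0; apply: le_trans (_ : 1 * (r t + r (t + pi)) <= _); first lra.
  by rewrite ler_wpM2r ?ler1n //; lra.
have /andP[? _] := vb 0; have /andP[? _] := vb (0 + pi).
have /andP[_ ?] := vb T; have /andP[_ ?] := vb (T + pi).
have : c * T = (c ^+ k.+1)^-1 + 1 by rewrite mulrC divfK // gt_eqF.
lra.
Qed.

End ScalarEquation.

(** * Backward solutions and a periodic solution of the scalar equation *)

Section Existence.
Context {R : realType}.
Implicit Types (r : R -> R) (s t x y c C M : R).
Variables (k : nat) (a b S : R -> R).
Hypothesis a_cont : continuous a.
Hypothesis b_cont : continuous b.
Hypothesis a_le0 : forall t, a t <= 0.
Hypothesis a_per : periodic a (pi *+ 2).
Hypothesis b_per : periodic b (pi *+ 2).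
Hypothesis S_prim : forall t, is_derive t 1 S (a t).
Hypothesis S_lt : S (pi *+ 2) < S 0.

Local Notation F := (polar_field k a b).

Let pi2_gt0 : 0 < pi *+ 2 :> R.
Proof. by rewrite pmulrn_lgt0 // pi_gt0. Qed.

(** Truncation to [[0, M]] makes the field bounded and globally Lipschitz; solutions that stay in
    this interval solve the original equation. *)
Definition clip M x : R := Num.max 0 (Num.min M x).

Lemma clip_itv M x : 0 <= M -> 0 <= clip M x <= M.
Proof. by move=> M0; rewrite /clip le_max lexx ge_max M0 ge_min lexx. Qed.

Lemma clip_id M x : 0 <= x <= M -> clip M x = x.
Proof.
by case/andP=> x0 xM; rewrite /clip (min_idPr xM) (max_idPr x0).
Qed.

Lemma clip_ge M x : 0 <= M -> M <= x -> clip M x = M.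
Proof. by move=> M0 Mx; rewrite /clip (min_idPl Mx) (max_idPr M0). Qed.

Lemma clip_lipschitz M x y : `|clip M x - clip M y| <= `|x - y|.
Proof.
rewrite /clip !maxEle !minEle.
by case: (leP M x); case: (leP M y); case: (leP 0 x); case: (leP 0 y);
  case: (leP 0 M); case: (ger0P (x - y)) => *;
  rewrite ?subrr ?normr0 ?ler_norml //; try (apply/andP; split); lra.
Qed.

Lemma polar_field_lipschitz M : 0 <= M -> exists2 L, 0 < L &
  forall t x y, 0 <= x <= M -> 0 <= y <= M ->
    `|F t x - F t y| <= L * `|x - y|.
Proof.
move=> M0.
have [A aA] := periodic_bounded _ _ a_cont pi2_gt0 a_per.
have [B bB] := periodic_bounded _ _ b_cont pi2_gt0 b_per.
have A0 := le_trans (normr_ge0 _) (aA 0).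
have B0 := le_trans (normr_ge0 _) (bB 0).
pose l j : R := j.+1%:R * M ^+ j.
have l0 j : 0 <= l j by rewrite mulr_ge0 ?ler0n ?exprn_ge0.
exists (l k.+2 + B * l k.+1 + A * l k + 1) => [|t x y x0 y0].
  by have := mulr_ge0 B0 (l0 k.+1); have := mulr_ge0 A0 (l0 k); have := l0 k.+2; lra.
have lip j : `|x ^+ j.+1 - y ^+ j.+1| <= l j * `|x - y|.
  have [T [-> /andP[T0 Tl]]] := subX_bounds 0 M x y j (lexx 0) x0 y0.
  rewrite normrM mulrC ler_wpM2r // ger0_norm //.
  by apply: le_trans T0; rewrite mulr_ge0 ?ler0n ?exprn_ge0.
have -> : F t x - F t y = (x ^+ k.+3 - y ^+ k.+3) + b t * (x ^+ k.+2 - y ^+ k.+2)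
    + a t * (x ^+ k.+1 - y ^+ k.+1).
  by rewrite /polar_field !exprS; ring.
rewrite !mulrDl mul1r.
apply: le_trans (ler_normD _ _) _; rewrite -[leLHS]addr0; apply: lerD => //.
apply: lerD; last by rewrite normrM -mulrA ler_pM.
apply: le_trans (ler_normD _ _) _; apply: lerD => //.
by rewrite normrM -mulrA ler_pM.
Qed.

Lemma clip_polar_ode M : 0 <= M -> exists2 L, 0 < L &
  (forall t x y, `|F t (clip M x) - F t (clip M y)| <= L * `|x - y|) /\
  forall t0 x0, exists r, r t0 = x0 /\
    forall t, is_derive t 1 r (F t (clip M (r t))).
Proof.
move=> M0; have [L L0 FL] := polar_field_lipschitz _ M0.
have hL t x y : `|F t (clip M x) - F t (clip M y)| <= L * `|x - y|.
  apply: le_trans (FL _ _ _ _ _) _; rewrite ?clip_itv //.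
  by rewrite ler_wpM2l ?clip_lipschitz // ltW.
exists L => //; split=> //.
apply: (@ode_exists _ (fun t x => F t (clip M x)) (L * M) L) => //.
  (* Since the field vanishes at 0, its Lipschitz estimate also bounds it by [L * M]. *)
  move=> t x; have F0 : F t 0 = 0 by rewrite /polar_field exprS !mul0r.
  have /andP[c0 cM] := clip_itv _ x M0.
  rewrite -[F t _]subr0 -[X in _ - X]F0.
  apply: le_trans (FL _ _ _ _ _) _; rewrite ?c0 ?cM ?lexx ?M0 //.
  by rewrite subr0 ger0_norm // ler_wpM2l // ltW.
move=> f cf.
have cc : continuous (fun t => clip M (f t)).
  move=> t; apply: (@continuous_comp _ _ _ f (clip M)); first exact: cf.
  apply: (@lipschitz_continuous _ _ 1) => u v.
  by rewrite mul1r; exact: clip_lipschitz.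
have cX j : continuous (fun t => clip M (f t) ^+ j).
  move=> t; apply: (@continuous_comp _ _ _ (fun t => clip M (f t)) (fun x : R => x ^+ j));
    first exact: cc.
  exact: exprn_continuous.
move=> t; apply: cvgM; first exact: cX.
apply: cvgD; last exact: a_cont.
by apply: cvgD; [exact: cX|apply: cvgM; [exact: b_cont|exact: cc]].
Qed.

(** Large constants are upper barriers backward in time: the quadratic term dominates there and the
    radius increases. *)
Lemma polar_field_large : exists2 M0, 0 < M0 &
  forall M t, M0 <= M -> 0 < F t M.
Proof.
have [A aA] := periodic_bounded _ _ a_cont pi2_gt0 a_per.
have [B bB] := periodic_bounded _ _ b_cont pi2_gt0 b_per.
have A0 := le_trans (normr_ge0 _) (aA 0).
have B0 := le_trans (normr_ge0 _) (bB 0).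
exists (A + B + 1) => [|M t MM]; first lra.
have M0 : 0 < M by lra.
rewrite /polar_field mulr_gt0 ?exprn_gt0 //.
have := aA t; have := bB t; rewrite !ler_norml => /andP[bt _] /andP[at_ _].
have : 0 <= M * (b t + B) by rewrite mulr_ge0 //; lra.
have : 0 <= (M - (A + B + 1)) * M by rewrite mulr_ge0 //; lra.
have : 0 <= A * (M - 1) by rewrite mulr_ge0 //; lra.
rewrite expr2; lra.
Qed.

(* Averaging: with [kappa] minus the mean of [a], the function
   [q t = S t + kappa * t] is periodic and
   [phi = e * exp (e ^+ k * q)] has [phi' = phi * e ^+ k * (a + kappa)], which
   exceeds the field at [phi] by the leading term [kappa * phi * e ^+ k]. *)
Lemma lower_barrier eta : 0 < eta -> exists phi phi' c,
  0 < c /\ forall t, [/\ phi (t + pi *+ 2) = phi t, c <= phi t <= eta,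
    is_derive t 1 phi (phi' t) & F t (phi t) <= phi' t].
Proof.
move=> eta0.
have [A aA] := periodic_bounded _ _ a_cont pi2_gt0 a_per.
have [B bB] := periodic_bounded _ _ b_cont pi2_gt0 b_per.
have A0 := le_trans (normr_ge0 _) (aA 0).
have B0 := le_trans (normr_ge0 _) (bB 0).
pose kappa := (S 0 - S (pi *+ 2)) / (pi *+ 2).
have kappa0 : 0 < kappa by rewrite divr_gt0 // subr_gt0.
pose q t := S t + kappa * t.
have dq t : is_derive t 1 q (a t + kappa).
  apply: is_derive_eq (is_derive_add _ _ _ _ _ (S_prim t)
    (is_derive_scale kappa _ _ _ (is_derive_var t))) _.
  by rewrite mulr1.
have q_per : periodic q (pi *+ 2).
  move=> t; apply/eqP; rewrite -subr_eq0; apply/eqP.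
  rewrite (@is_derive0_const _ (fun u => q (u + pi *+ 2) - q u) _ t 0).
    rewrite /q add0r mulr0 addr0 /kappa divfK ?gt_eqF //; ring.
  move=> u; apply: is_derive_eq (is_derive_sub _ _ _ _ _
    (is_derive_shiftr q (pi *+ 2) u _ (dq (u + pi *+ 2))) (dq u)) _.
  by rewrite a_per subrr.
have cq : continuous q by move=> t; exact: is_derive_cont (dq t).
have [Q qQ] := periodic_bounded _ _ cq pi2_gt0 q_per.
have Q0 := le_trans (normr_ge0 _) (qQ 0).
(* With E = exp(k e^k q), the barrier inequality reduces to E (phi^2 + b phi) + (E - 1) a <= kappa.
   [Psi e] bounds the left side uniformly in time and tends to 0 with [e]. *)
pose Psi (e : R) := expR (k%:R * Q * e) * (expR Q * expR Q * (e * e) + B * expR Q * e)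
  + A * (expR (k%:R * Q * e) - 1).
have cPsi : {for 0, continuous Psi}.
  have cE c : {for 0, continuous (fun e => c * e)}.
    by apply: cvgM; [exact: cvg_cst|exact: cvg_id].
  have cX : {for 0, continuous (fun e : R => expR (k%:R * Q * e))}.
    apply: (@continuous_comp _ _ _ (fun e => k%:R * Q * e) expR); first exact: cE.
    exact: continuous_expR.
  apply: cvgD.
    apply: cvgM; first exact: cX.
    apply: cvgD; last exact: cE.
    by apply: cvgM; [exact: cvg_cst|apply: cvgM; exact: cvg_id].
  apply: cvgM; first exact: cvg_cst.
  by apply: cvgB; [exact: cX|exact: cvg_cst].
have Psi0 : Psi 0 = 0 by rewrite /Psi !mulr0 expR0; ring.
have Psi_small : \forall e \near (0 : R)^'+, Psi e < kappa.
  have : \forall e \near (0 : R), Psi e < kappa.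
    by apply: (@cvgr_lt _ _ _ _ Psi (Psi 0) cPsi); rewrite Psi0.
  by apply: filterS => e + _.
(* [e <= 1] keeps the exponent of [phi] within [Q], the third condition gives [phi <= eta], and the
   last one gives the differential inequality. *)
have [e [e0 e1 eQ eP]] : exists e, [/\ 0 < e, e <= 1, e <= eta / expR Q & Psi e < kappa].
  near (0 : R)^'+ => e; exists e; split.
  - by near: e; exact: nbhs_right_gt.
  - by near: e; exact: nbhs_right_le.
  - by near: e; apply: nbhs_right_le; rewrite divr_gt0 // expR_gt0.
  - by near: e; exact: Psi_small.
have ek1 : e ^+ k <= 1 by rewrite exprn_ile1 // ltW.
have ek0 : 0 < e ^+ k by exact: exprn_gt0.
pose phi t := e * expR (e ^+ k * q t).
pose phi' t := phi t * (e ^+ k * (a t + kappa)).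
have eqQ t : `|e ^+ k * q t| <= Q.
  rewrite normrM (ger0_norm (ltW ek0)); apply: le_trans (qQ t).
  by rewrite ler_piMl.
have phi_itv t : e * expR (- Q) <= phi t <= e * expR Q.
  have /andP[? ?] : - Q <= e ^+ k * q t <= Q by rewrite -ler_norml.
  by rewrite !ler_pM2l // !ler_expR; apply/andP.
have phi0 t : 0 < phi t by rewrite mulr_gt0 // expR_gt0.
exists phi, phi', (e * expR (- Q)); split; first by rewrite mulr_gt0 // expR_gt0.
move=> t; have /andP[phil phiu] := phi_itv t; split.
- by rewrite /phi q_per.
- by rewrite phil (le_trans phiu) // -ler_pdivlMr ?expR_gt0.
- apply: is_derive_eq (is_derive_scale e _ _ _ (is_derive_exp _ _ _
    (is_derive_scale (e ^+ k) _ _ _ (dq t)))) _.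
  by rewrite /phi' /phi; ring.
pose E := expR (k%:R * (e ^+ k * q t)).
have phik : phi t ^+ k = e ^+ k * E by rewrite /phi exprMn /E mulrC expRM_natl mulrC.
have -> : F t (phi t) = phi t * (e ^+ k * (E * (phi t ^+ 2 + b t * phi t + a t))).
  by rewrite /polar_field exprS phik; ring.
rewrite /phi' ler_pM2l // ler_pM2l //.
pose Z := expR (k%:R * Q * e).
(* For [k = 0] both sides vanish; otherwise [e ^+ k <= e]. *)
have keq : `|k%:R * (e ^+ k * q t)| <= k%:R * Q * e.
  rewrite normrM ger0_norm ?ler0n // -mulrA; case: (k) => [|j].
    by rewrite !mul0r.
  rewrite ler_wpM2l ?ler0n // normrM mulrC ler_pM // ger0_norm ?exprn_ge0 ?(ltW e0) //.
  by rewrite exprS ler_piMr ?(ltW e0) // exprn_ile1 // ltW.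
have EZ : E <= Z by rewrite ler_expR; apply: le_trans keq; exact: ler_norm.
have E0 : 0 < E by exact: expR_gt0.
(* The inequality 1 + x <= exp(x), applied to both exponents, bounds [E] below; with [E <= Z] it
   gives |E - 1| <= Z - 1. *)
have ZE : 2 - Z <= E.
  have := expR_ge1Dx (k%:R * (e ^+ k * q t)); have := expR_ge1Dx (k%:R * Q * e).
  rewrite -/E -/Z; move: keq; rewrite ler_norml => /andP[]; lra.
have Z0 : 0 < Z by exact: expR_gt0.
have := aA t; have := bB t; rewrite !ler_norml => /andP[_ bt] /andP[at_ _].
have t1 : E * phi t ^+ 2 <= Z * (expR Q * expR Q * (e * e)).
  apply: ler_pM => //; rewrite ?sqr_ge0 ?(ltW E0) // expr2.
  have -> : expR Q * expR Q * (e * e) = (e * expR Q) * (e * expR Q) by ring.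
  by apply: ler_pM; rewrite ?(ltW (phi0 t)).
have t2 : E * (b t * phi t) <= Z * (B * expR Q * e).
  have [b0|b0] := leP 0 (b t).
    have -> : B * expR Q * e = B * (e * expR Q) by ring.
    apply: (@ler_pM _ E Z (b t * phi t)) => //; first exact: ltW.
      by rewrite mulr_ge0 // ltW.
    by apply: ler_pM => //; exact: ltW.
  apply: le_trans (_ : 0 <= _).
    by rewrite pmulr_rle0 // nmulr_rle0 // ltW.
  by rewrite !mulr_ge0 ?expR_ge0 // ltW.
have t3 : (E - 1) * a t <= A * (Z - 1).
  have [E1|E1] := leP 0 (E - 1).
    apply: le_trans (_ : 0 <= _); first by rewrite mulr_ge0_le0.
    by rewrite mulr_ge0 //; lra.
  have : (1 - E) * (- a t) <= (Z - 1) * A.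
    by apply: ler_pM; have := a_le0 t; lra.
  lra.
move: eP; rewrite /Psi -/Z; lra.
Unshelve. all: by end_near.
Qed.

(** The region between [phi] and [M] is invariant backward in time: above [M] the clipped field is
    positive, and below [phi] the Lipschitz bound compares [r] with the barrier. *)
Lemma clip_polar_region M phi phi' r t0 : 0 <= M -> (forall t, 0 < F t M) ->
  (forall t, 0 <= phi t <= M) -> (forall t, is_derive t 1 phi (phi' t)) ->
  (forall t, F t (phi t) <= phi' t) ->
  (forall t, is_derive t 1 r (F t (clip M (r t)))) -> phi t0 <= r t0 <= M ->
  forall t, t <= t0 -> phi t <= r t <= M.
Proof.
move=> M0 FM phiM dphi Fphi dr /andP[r0 rM] t tt0; apply/andP; split.
  have [L L0 [FL _]] := clip_polar_ode _ M0.
  (* The inequality for [phi] is not strict. The rate [L + 1], exceeding the Lipschitz constant,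
     makes the derivative of [D] strictly negative where [r < phi]. *)
  pose D u := (r u - phi u) * expR ((L + 1) * u).
  pose D' u := (F u (clip M (r u)) - phi' u + (L + 1) * (r u - phi u)) * expR ((L + 1) * u).
  suff : 0 <= D t by rewrite pmulr_lge0 ?expR_gt0 // subr_ge0.
  apply: (@barrier _ D D' t0) => // [u| |u ut].
  - apply: is_derive_eq (is_derive_mul _ _ _ _ _ (is_derive_sub _ _ _ _ _ (dr u) (dphi u))
      (is_derive_exp _ _ _ (is_derive_scale (L + 1) _ _ _ (is_derive_var u)))) _.
    by rewrite /D'; ring.
  - by rewrite mulr_ge0 ?expR_ge0 // subr_ge0.
  - rewrite pmulr_llt0 ?expR_gt0 // subr_lt0 => rphi.
    rewrite pmulr_llt0 ?expR_gt0 //.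
    have := FL u (r u) (phi u); rewrite (clip_id _ _ (phiM u)).
    rewrite [`|r u - _|]ltr0_norm ?subr_lt0 // ler_norml => /andP[_].
    have := Fphi u; lra.
rewrite -subr_ge0.
apply: (@barrier _ (fun u => M - r u) (fun u => 0 - F u (clip M (r u))) t0) => // [|u ut].
  by rewrite subr_ge0.
rewrite subr_lt0 => Mr; rewrite clip_ge ?(ltW Mr) //.
by rewrite sub0r oppr_lt0.
Qed.

(** A lower barrier below [x0] and a constant above it confine the solution for all past times. The
    margin [T] past [t0] comes from continuity. *)
Lemma backward_solution t0 x0 : 0 < x0 -> exists r c C T,
  [/\ 0 < c, 0 < T, r t0 = x0 & forall t, t < t0 + T ->
    c <= r t <= C /\ is_derive t 1 r (F t (r t))].
Proof.
move=> x00; have [M0 M00 FM0] := polar_field_large.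
pose M := M0 + x0 + 1; have M_gt0 : 0 < M by rewrite /M; lra.
have FM t : 0 < F t M by apply: FM0; rewrite /M; lra.
have [phi [phi' [c [c0 phiP]]]] := lower_barrier _ x00.
have [L L0 [FL /(_ t0 x0)[r [r0 dr]]]] := clip_polar_ode _ (ltW M_gt0).
have cr : {for t0, continuous r} by exact: is_derive_cont (dr t0).
have rnear : \forall t \near t0, x0 / 2 < r t < M.
  near=> t; apply/andP; split.
    by near: t; apply: (@cvgr_gt _ _ _ _ r (r t0) cr); rewrite r0; lra.
  by near: t; apply: (@cvgr_lt _ _ _ _ r (r t0) cr); rewrite r0 /M; lra.
have [T T0 rT] := (@nbhs_ballP _ _ _ _).1 rnear.
have phi_lo t : c <= phi t by have [_ /andP[]] := phiP t.
have phi_hi t : phi t <= x0 by have [_ /andP[]] := phiP t.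
have rb t : t < t0 + T -> Num.min c (x0 / 2) <= r t <= M.
  move=> tT; have [tt0|tt0] := leP t t0.
    have /andP[r1 r2] : phi t <= r t <= M.
      apply: (@clip_polar_region M phi phi' r t0) => //; first exact: ltW.
      - move=> u; have := phi_lo u; have := phi_hi u; rewrite /M.
        by move=> *; apply/andP; split; lra.
      - by move=> u; have [] := phiP u.
      - by move=> u; have [] := phiP u.
      - by rewrite r0 phi_hi /M; apply/andP; split=> //; lra.
    by rewrite ge_min (le_trans (phi_lo t)).
  have /andP[r1 r2] : x0 / 2 < r t < M.
    apply: rT; rewrite /ball /= distrC ger0_norm; lra.
  by rewrite ge_min (ltW r1) orbT ltW.
have cx : 0 < Num.min c (x0 / 2) by rewrite lt_min c0 /=; lra.
exists r, (Num.min c (x0 / 2)), M, T; split=> // t tT; split; first exact: rb.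
have /andP[r1 r2] := rb t tT.
have := dr t; rewrite clip_id //.
by rewrite (le_trans _ r1) // ltW.
Unshelve. all: by end_near. Qed.

(** This yields both the continuity of the Poincare map and the uniqueness of solutions of the
    clipped equation. *)
Lemma clip_polar_gronwall M L r1 r2 s t : 0 < L ->
  (forall t x y, `|F t (clip M x) - F t (clip M y)| <= L * `|x - y|) ->
  (forall t, is_derive t 1 r1 (F t (clip M (r1 t)))) ->
  (forall t, is_derive t 1 r2 (F t (clip M (r2 t)))) ->
  `|r1 t - r2 t| <= expR (L * `|t - s|) * `|r1 s - r2 s|.
Proof.
move=> L0 FL d1 d2.
have := @gronwall _ (fun u => r1 u - r2 u)
  (fun u => F u (clip M (r1 u)) - F u (clip M (r2 u))) L
  (fun u => is_derive_sub _ _ _ _ _ (d1 u) (d2 u)) (fun u => FL u _ _) s t.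
rewrite -[leLHS]real_normK ?num_real // -[(r1 s - _) ^+ 2]real_normK ?num_real //.
rewrite -mulrA mulr_natl mulr2n expRD -expr2 -exprMn.
by rewrite ler_pXn2r // ?nnegrE ?mulr_ge0 ?expR_ge0 // mulrC.
Qed.

(** The backward Poincare map [P] sends [[phi 0, M]] into itself, so it has a fixed point, whose
    trajectory is periodic by uniqueness. *)
Lemma periodic_solution : exists r c C, 0 < c /\ forall t,
  [/\ r (t + pi *+ 2) = r t, c <= r t <= C & is_derive t 1 r (F t (r t))].
Proof.
have [M0 M00 FM0] := polar_field_large.
pose M := M0 + 1; have M_gt0 : 0 < M by rewrite /M; lra.
have FM t : 0 < F t M by apply: FM0; rewrite /M; lra.
have [phi [phi' [c [c0 phiP]]]] := lower_barrier _ (@ltr01 R).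
have [L L0 [FL /(_ 0)/choice[rs rsP]]] := clip_polar_ode _ (ltW M_gt0).
have phi_lo t : c <= phi t by have [_ /andP[]] := phiP t.
have phi_hi t : phi t <= M.
  by have [_ /andP[_ /le_trans->]] := phiP t => //; rewrite /M; lra.
have rsM x t : phi 0 <= x <= M -> t <= 0 -> phi t <= rs x t <= M.
  move=> xM t0; have [x0 dx] := rsP x.
  apply: (@clip_polar_region M phi phi' (rs x) 0) => //.
  - exact: ltW.
  - by move=> u; rewrite (le_trans (ltW c0) (phi_lo u)) phi_hi.
  - by move=> u; have [] := phiP u.
  - by move=> u; have [] := phiP u.
  - by rewrite x0.
pose P x := rs x (- (pi *+ 2)).
have Pcont : continuous P.
  apply: (@lipschitz_continuous _ _ (expR (L * `|- (pi *+ 2) - 0|))) => x y.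
  have [x0 dx] := rsP x; have [y0 dy] := rsP y.
  by have := @clip_polar_gronwall M L _ _ 0 (- (pi *+ 2)) L0 FL dx dy; rewrite x0 y0.
have phi_per : phi (- (pi *+ 2)) = phi 0.
  by have [<- _ _ _] := phiP (- (pi *+ 2)); rewrite addNr.
have P_itv x : phi 0 <= x <= M -> phi 0 <= P x <= M.
  by move=> xM; rewrite -[X in X <= P x]phi_per; apply: rsM => //; rewrite oppr_le0 ltW.
have [x xM Px] : exists2 x, x \in `[phi 0, M] & P x - x = 0.
  apply: (@IVT _ (fun x => P x - x)) => //.
    apply: continuous_within_itv => x.
    by apply: cvgB; [exact: Pcont|exact: cvg_id].
  have /P_itv/andP[p1 _] : phi 0 <= phi 0 <= M by rewrite lexx phi_hi.
  have /P_itv/andP[_ p2] : phi 0 <= M <= M by rewrite phi_hi lexx.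
  by rewrite ge_min le_max !subr_ge0 !subr_le0 p1 p2 orbT.
rewrite in_itv /= in xM.
have [x0 dx] := rsP x.
(* The shifted function solves the same equation and agrees with [rs x] at time -2 pi because [x] is
   fixed by [P]. *)
have r_per t : rs x (t + pi *+ 2) = rs x t.
  have dshift (u : R) : is_derive u 1 (fun v => rs x (v + pi *+ 2))
      (F u (clip M (rs x (u + pi *+ 2)))).
    apply: is_derive_eq (is_derive_shiftr _ _ _ _ (dx (u + pi *+ 2))) _.
    by rewrite /polar_field a_per b_per.
  apply/eqP; rewrite -subr_eq0 -normr_le0.
  apply: le_trans (@clip_polar_gronwall M L _ _ (- (pi *+ 2)) t L0 FL dshift dx) _.
  rewrite addNr x0 -[rs x _]/(P x) distrC.
  by move/eqP: Px; rewrite subr_eq0 => /eqP->; rewrite subrr normr0 mulr0.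
(* The region bounds hold only for nonpositive times; subtracting [j + 1] periods moves any time
   there. *)
have rM t : c <= rs x t <= M.
  have [j /andP[_ jt]] := periodic_reduce (pi *+ 2) t pi2_gt0.
  rewrite -(subrK (pi *+ 2 *~ (j + 1)) t) periodicz //.
  have t0 : t - pi *+ 2 *~ (j + 1) <= 0.
    by rewrite mulrzDr mulr1z; lra.
  have /andP[r1 ->] := rsM x _ xM t0.
  by rewrite (le_trans (phi_lo _) r1).
exists (rs x), c, M; split=> // t; split=> //.
have := dx t; rewrite clip_id //.
by have /andP[r1 ->] := rM t; rewrite (le_trans (ltW c0)).
Qed.

End Existence.

(** * The planar system *)

Section Polynomials.
Context {R : realType}.

Lemma eval2E (P : mpoly2 R) x y : eval2 P x y =
  \sum_(m <- msupp P) mcoeff m P *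
    (x ^+ m ord0 * y ^+ m (lift ord0 ord0)).
Proof.
rewrite /eval2 mevalE; apply: eq_bigr => m _.
by rewrite big_ord_recl big_ord1.
Qed.

Lemma eval2_homogeneous d (P : mpoly2 R) r x y : homogeneous d P ->
  eval2 P (r * x) (r * y) = r ^+ d * eval2 P x y.
Proof.
move=> /dhomogP homP; rewrite !eval2E mulr_sumr big_seq [RHS]big_seq.
apply: eq_bigr => m mP; have <- : mdeg m = d by exact: homP m mP.
rewrite !exprMn mdegE.
rewrite big_ord_recl big_ord1 exprD; ring.
Qed.

Lemma eval2_continuous (P : mpoly2 R) (x y : R -> R) :
  continuous x -> continuous y -> continuous (fun t => eval2 P (x t) (y t)).
Proof.
move=> cx cy; under eq_fun do rewrite eval2E.
have cX (z : R -> R) j : continuous z -> continuous (fun t => z t ^+ j).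
  move=> cz t; apply: (@continuous_comp _ _ _ z (fun u : R => u ^+ j)); first exact: cz.
  exact: exprn_continuous.
elim: (msupp P) => [|m l IH].
  by under eq_fun do rewrite big_nil; move=> t; rewrite big_nil; exact: cvg_cst.
under eq_fun do rewrite big_cons.
move=> t; rewrite big_cons; apply: cvgD; last exact: IH.
by apply: cvgM; [exact: cvg_cst|apply: cvgM; exact: cX].
Qed.

End Polynomials.

(** * Derivatives of planar curves *)

Section PairDerivative.
Context {R : realType}.

Lemma is_derive1P {V : normedModType R} (f : R -> V) (t : R) df :
  is_derive t 1 f df <-> h^-1 *: (f (h + t) - f t) @[h --> 0^'] --> df.
Proof.
have E : (fun h : R => h^-1 *: ((f \o shift t) (h *: (1 : R)) - f t)) =
    (fun h : R => h^-1 *: (f (h + t) - f t)).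
  by apply/funext => h /=; rewrite /GRing.scale/= mulr1.
split=> [[df1 df2]|df1].
  by rewrite -df2 /derive E; move: df1; rewrite /derivable E.
apply: DeriveDef; last by rewrite /derive E; exact: cvg_lim.
by rewrite /derivable E; apply/cvg_ex; exists df.
Qed.

Lemma is_derive_pairP (g : R -> R * R) (t : R) (v : R * R) :
  is_derive t 1 g v <->
  is_derive t 1 (fun s => (g s).1) v.1 /\ is_derive t 1 (fun s => (g s).2) v.2.
Proof.
rewrite !is_derive1P; split=> [H|[H1 H2]].
  have f1 : (fun p : R * R => p.1) @ v --> v.1.
    exact: (@cvg_fst R R (nbhs v.1) (nbhs v.2)).
  have f2 : (fun p : R * R => p.2) @ v --> v.2.
    exact: (@cvg_snd R R (nbhs v.1) (nbhs v.2)).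
  by split; [exact: (cvg_comp _ _ H f1)|exact: (cvg_comp _ _ H f2)].
case: v H1 H2 => v1 v2 H1 H2; exact: cvg_pair H1 H2.
Qed.

End PairDerivative.

(** * Polar coordinates *)

Section Polar.
Context {R : realType}.
Implicit Types (p q x y s t : R).

Definition polar_curve (r : R -> R) t : R * R := (r t * cos t, r t * sin t).

Lemma polar_decomposition p q : 0 < p ^+ 2 + q ^+ 2 ->
  exists rho alpha, [/\ 0 < rho, p = rho * cos alpha & q = rho * sin alpha].
Proof.
move=> pq; pose rho := Num.sqrt (p ^+ 2 + q ^+ 2).
have rho0 : 0 < rho by rewrite sqrtr_gt0.
have rho2 : rho ^+ 2 = p ^+ 2 + q ^+ 2 by rewrite sqr_sqrtr // ltW.
have u2 : (p / rho) ^+ 2 + (q / rho) ^+ 2 = 1.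
  by rewrite !expr_div_n -mulrDl -rho2 divff // expf_neq0 // gt_eqF.
have u1 : -1 <= p / rho <= 1.
  rewrite -ler_norml -(@ler_pXn2r _ 2) ?nnegrE // real_normK ?num_real // expr1n -u2.
  by rewrite lerDl sqr_ge0.
have pE : p = rho * (p / rho) by rewrite mulrC divfK // gt_eqF.
have qE : q = rho * (q / rho) by rewrite mulrC divfK // gt_eqF.
have sE : sin (acos (p / rho)) = `|q / rho|.
  by rewrite sin_acos // -u2 addrC addKr sqrtr_sqr.
have [q0|q0] := leP 0 (q / rho).
  exists rho, (acos (p / rho)); split=> //; first by rewrite acosK.
  by rewrite sE ger0_norm.
exists rho, (- acos (p / rho)); split=> //; first by rewrite cosN acosK.
by rewrite sinN sE ltr0_norm // opprK.
Qed.

Lemma polar_curve_dist (r1 r2 : R -> R) t e :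
  `|r1 t - r2 t| < e -> ball (polar_curve r1 t) e (polar_curve r2 t).
Proof.
move=> re; split; rewrite /ball /= -mulrBl normrM; apply: le_lt_trans re;
  by rewrite ler_piMr // ?cos_max ?sin_max.
Qed.

Lemma norm_sqr_polar_curve (r : R -> R) t :
  (polar_curve r t).1 ^+ 2 + (polar_curve r t).2 ^+ 2 = r t ^+ 2.
Proof. by rewrite /= !exprMn -mulrDr cos2Dsin2 mulr1. Qed.

Lemma polar_curve_periodic (r : R -> R) : periodic r (pi *+ 2) ->
  periodic (polar_curve r) (pi *+ 2).
Proof. by move=> rp t; rewrite /polar_curve rp cosD2pi sinD2pi. Qed.

End Polar.

(** * Reduction of the rigid system to the scalar equation *)

Section RigidSystem.
Context {R : realType}.
Implicit Types (s t : R) (r : R -> R).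
Variables (k : nat) (R1 R2 R3 : mpoly2 R).
Hypothesis k_even : ~~ odd k.
Hypothesis hom1 : homogeneous k.+2 R1.
Hypothesis hom2 : homogeneous k.+1 R2.
Hypothesis hom3 : homogeneous k R3.
Hypothesis R1_one : forall t : R, eval2 R1 (cos t) (sin t) = 1.
Hypothesis R3_le0 : forall t : R, eval2 R3 (cos t) (sin t) <= 0.

Let f x y := eval2 R1 x y + eval2 R2 x y + eval2 R3 x y.
Let V := rigid_field f.
Let a t := eval2 R3 (cos t) (sin t).
Let b t := eval2 R2 (cos t) (sin t).
Let F := polar_field k a b.

Let continuous_a : continuous a.
Proof. exact: (eval2_continuous _ cos sin (@continuous_cos R) (@continuous_sin R)). Qed.

Let continuous_b : continuous b.
Proof. exact: (eval2_continuous _ cos sin (@continuous_cos R) (@continuous_sin R)). Qed.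

(** Adding pi to the angle negates the point and multiplies a form of degree d by (-1)^d; the degree
    is even here and odd for [b]. *)
Let a_pi : periodic a pi.
Proof.
move=> t; rewrite /a cosDpi sinDpi -[- cos t]mulN1r -[- sin t]mulN1r.
by rewrite (eval2_homogeneous _ _ _ _ _ hom3) -signr_odd (negbTE k_even) expr0 mul1r.
Qed.

Let b_pi : alternating b pi.
Proof.
move=> t; rewrite /b cosDpi sinDpi -[- cos t]mulN1r -[- sin t]mulN1r.
rewrite (eval2_homogeneous _ _ _ _ _ hom2) -signr_odd /= (negbTE k_even) /=.
by rewrite expr1 mulN1r.
Qed.

Let a_2pi : periodic a (pi *+ 2).
Proof. by move=> t; rewrite mulr2n addrA !a_pi. Qed.

Let b_2pi : periodic b (pi *+ 2).
Proof. by move=> t; rewrite mulr2n addrA !b_pi opprK. Qed.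

Let pi2_gt0 : 0 < pi *+ 2 :> R.
Proof. by rewrite pmulrn_lgt0 // pi_gt0. Qed.

Lemma rigid_polar r t : r t * f (r t * cos t) (r t * sin t) = F t (r t).
Proof.
rewrite /f !(eval2_homogeneous _ _ _ _ _ hom1) !(eval2_homogeneous _ _ _ _ _ hom2).
rewrite !(eval2_homogeneous _ _ _ _ _ hom3) R1_one /F /polar_field !exprS /a /b; ring.
Qed.

(** The angle moves at unit speed, so it is time plus the constant [alpha], and the scalar equation
    in the angle gives a planar solution. *)
Lemma polar_solution r alpha t :
  is_derive (t + alpha) 1 r (F (t + alpha) (r (t + alpha))) ->
  is_derive t 1 (fun s => polar_curve r (s + alpha)) (V (polar_curve r (t + alpha))).
Proof.
move=> dr; apply/is_derive_pairP; rewrite /polar_curve /V /rigid_field /=.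
rewrite -rigid_polar in dr.
have dcos := is_derive_shiftr _ _ _ _ (is_derive_cos (t + alpha)).
have dsin := is_derive_shiftr _ _ _ _ (is_derive_sin (t + alpha)).
have dr' := is_derive_shiftr _ _ _ _ dr.
split.
  by apply: is_derive_eq (is_derive_mul _ _ _ _ _ dr' dcos) _; ring.
by apply: is_derive_eq (is_derive_mul _ _ _ _ _ dr' dsin) _; ring.
Qed.

(** Along [g] the factor f is a known function of time, so the system is linear: a rotation combined
    with scaling by the exponential of a primitive [W]. This provides a global angle without
    lifting. *)
Lemma solution_polar (g : R -> R * R) : solution_on V setT g ->
  (exists t, g t != 0) -> exists r alpha,
    [/\ forall t, 0 < r t, forall t, is_derive t 1 r (F t (r t))
      & forall t, g t = polar_curve r (t + alpha)].
Proof.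
move=> gV [t0 gt0].
pose x t := (g t).1; pose y t := (g t).2; pose w t := f (x t) (y t).
have dx t : is_derive t 1 x (- y t + x t * w t).
  by have /is_derive_pairP[] := gV t I.
have dy t : is_derive t 1 y (x t + y t * w t).
  by have /is_derive_pairP[] := gV t I.
have cx : continuous x by move=> t; exact: is_derive_cont (dx t).
have cy : continuous y by move=> t; exact: is_derive_cont (dy t).
have cw : continuous w.
  move=> t; apply: cvgD; last exact: (eval2_continuous R3 _ _ cx cy).
  apply: cvgD; first exact: (eval2_continuous R1 _ _ cx cy).
  exact: (eval2_continuous R2 _ _ cx cy).
have [W [W0 dW]] := continuous_primitive w cw.
have dE t : is_derive t 1 (fun s => expR (- W s)) (expR (- W t) * - w t).
  exact: is_derive_exp (is_derive_opp _ _ _ (dW t)).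
(* Undoing the rotation and the scaling gives two conserved quantities. *)
pose p t := (x t * cos t + y t * sin t) * expR (- W t).
pose q t := (y t * cos t - x t * sin t) * expR (- W t).
have pC t : p t = p 0.
  apply: is_derive0_const => s.
  apply: is_derive_eq (is_derive_mul _ _ _ _ _ (is_derive_add _ _ _ _ _
    (is_derive_mul _ _ _ _ _ (dx s) (is_derive_cos s))
    (is_derive_mul _ _ _ _ _ (dy s) (is_derive_sin s))) (dE s)) _.
  ring.
have qC t : q t = q 0.
  apply: is_derive0_const => s.
  apply: is_derive_eq (is_derive_mul _ _ _ _ _ (is_derive_sub _ _ _ _ _
    (is_derive_mul _ _ _ _ _ (dy s) (is_derive_cos s))
    (is_derive_mul _ _ _ _ _ (dx s) (is_derive_sin s))) (dE s)) _.
  ring.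
have eW t : expR (- W t) * expR (W t) = 1 by rewrite -expRD addNr expR0.
have cs t : cos t * cos t + sin t * sin t = 1 by rewrite -!expr2 cos2Dsin2.
have xE t : x t = expR (W t) * (p 0 * cos t - q 0 * sin t).
  rewrite -(pC t) -(qC t) /p /q.
  transitivity (x t * (expR (- W t) * expR (W t)) * (cos t * cos t + sin t * sin t)).
    by rewrite eW cs !mulr1.
  ring.
have yE t : y t = expR (W t) * (p 0 * sin t + q 0 * cos t).
  rewrite -(pC t) -(qC t) /p /q.
  transitivity (y t * (expR (- W t) * expR (W t)) * (cos t * cos t + sin t * sin t)).
    by rewrite eW cs !mulr1.
  ring.
(* If both constants vanished, [g] would be identically zero. *)
have pq : 0 < p 0 ^+ 2 + q 0 ^+ 2.
  rewrite lt_neqAle addr_ge0 ?sqr_ge0 // andbT eq_sym paddr_eq0 ?sqr_ge0 //.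
  rewrite !sqrf_eq0; apply: contra gt0 => /andP[/eqP p0 /eqP q0].
  rewrite [g t0]surjective_pairing -[_.1]/(x t0) -[_.2]/(y t0) xE yE p0 q0.
  by rewrite !mul0r subrr addr0 mulr0.
have [rho [alpha [rho0 pE qE]]] := polar_decomposition _ _ pq.
pose r t := rho * expR (W (t - alpha)).
have gE t : g t = polar_curve r (t + alpha).
  rewrite [g t]surjective_pairing -[_.1]/(x t) -[_.2]/(y t) /polar_curve /r addrK.
  by rewrite xE yE pE qE cosD sinD; congr (_, _); ring.
exists r, alpha; split=> // [t|t]; first by rewrite mulr_gt0 // expR_gt0.
rewrite -rigid_polar.
have := gE (t - alpha); rewrite subrK => E.
have -> : f (r t * cos t) (r t * sin t) = w (t - alpha) by rewrite /w /x /y E.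
apply: is_derive_eq (is_derive_scale rho _ _ _ (is_derive_exp _ _ _
  (is_derive_shiftr W (- alpha) t _ (dW (t - alpha))))) _.
by rewrite /r mulrA.
Qed.

(** Being positive with square the squared norm along [g], the radius inherits the period [T]; hence
    it and its inverse are bounded. *)
Lemma periodic_orbit_polar G : periodic_orbit V G -> exists r c C,
  [/\ 0 < c, forall t, c <= r t <= C, forall t, is_derive t 1 r (F t (r t))
    & G = range (polar_curve r)].
Proof.
move=> [g [T [gV T0 gT [t0 gt0] ->]]].
have [|r [alpha [r0 dr gE]]] := solution_polar _ gV.
  have [g0|g0] := eqVneq (g t0) 0; last by exists t0.
  by exists 0; rewrite -g0 eq_sym.
have rT : periodic r T.
  move=> t; have E : r (t + T) ^+ 2 = r t ^+ 2.
    rewrite -(norm_sqr_polar_curve r t) -(norm_sqr_polar_curve r (t + T)).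
    by have := gT (t - alpha); rewrite !gE addrAC subrK => ->.
  apply/eqP; have := eqrXn2 (n := 2) isT (ltW (r0 (t + T))) (ltW (r0 t)).
  by rewrite E eqxx => <-.
have cr : continuous r by move=> t; exact: is_derive_cont (dr t).
have [C rC] := periodic_bounded _ _ cr T0 rT.
have [||D rD] := periodic_bounded (fun t => (r t)^-1) _ _ T0.
- by move=> t; apply: cvgV; [rewrite gt_eqF|exact: cr].
- by move=> t; rewrite rT.
have D0 : 0 < D by apply: lt_le_trans (rD 0); rewrite normr_gt0 invr_neq0 // gt_eqF.
exists r, D^-1, C; split=> //.
- by rewrite invr_gt0.
- move=> t; apply/andP; split; last exact: le_trans (ler_norm _) (rC t).
  by rewrite -[r t]invrK lef_pV2 ?posrE ?invr_gt0 // (le_trans _ (rD t)) // ler_norm.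
- apply/seteqP; split=> _ [t _ <-]; first by exists (t + alpha).
  by exists (t - alpha) => //; rewrite gE subrK.
Qed.

(** Both solutions exist for all future times, so the backward contraction can be started
    arbitrarily late. *)
Lemma bounded_polar_unique r1 r2 c1 c2 C1 C2 : 0 < c1 -> 0 < c2 ->
  (forall t, c1 <= r1 t <= C1) -> (forall t, c2 <= r2 t <= C2) ->
  (forall t, is_derive t 1 r1 (F t (r1 t))) ->
  (forall t, is_derive t 1 r2 (F t (r2 t))) -> r1 = r2.
Proof.
move=> c10 c20 b1 b2 d1 d2; apply/funext => s.
have c0 : 0 < Num.min c1 c2 by rewrite lt_min c10.
have [D [gam [gam0 H]]] := polar_contraction k a b R3_le0 _ (Num.max C1 C2) c0.
have {H} close t : s <= t -> `|r2 s - r1 s| <= D * expR (- (gam * (t - s))).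
  move=> st; apply: (H r1 r2 t) => // u _; split=> //.
    have /andP[u1 u2] := b1 u.
    by rewrite ge_min u1 le_max u2.
  have /andP[u1 u2] := b2 u.
  by rewrite ge_min u1 le_max u2 !orbT.
apply/eqP; rewrite eq_sym -subr_eq0 -normr_le0 leNgt; apply/negP => d0.
set d := `|_| in close d0.
have D0 : 0 <= D.
  by have := close s (lexx s); rewrite subrr mulr0 oppr0 expR0 mulr1; apply: le_trans; exact: ltW.
(* At this time the exponent is D/d, and exp(D/d) >= 1 + D/d turns the estimate into d + D <= D. *)
have := close (s + D / (d * gam)).
have u0 : 0 <= D / (d * gam) by rewrite divr_ge0 // ltW // mulr_gt0.
rewrite lerDl => /(_ u0).
have -> : gam * (s + D / (d * gam) - s) = D / d by field; rewrite !gt_eqF.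
rewrite expRN ler_pdivlMr ?expR_gt0 // => /(le_trans _) H.
have : d * (1 + D / d) <= D by apply: H; rewrite ler_pM2l // expR_ge1Dx.
by rewrite mulrDr mulr1 mulrC divfK ?gt_eqF //; lra.
Qed.

Lemma periodic_orbit_subset1 : is_subset1 (periodic_orbit V).
Proof.
move=> G1 G2 /periodic_orbit_polar[r1 [c1 [C1 [c10 b1 d1 ->]]]].
move=> /periodic_orbit_polar[r2 [c2 [C2 [c20 b2 d2 ->]]]].
by rewrite (bounded_polar_unique _ _ _ _ _ _ c10 c20 b1 b2 d1 d2).
Qed.


(** Around a center, periodic orbits pass through all points [(e, 0)] with small [e > 0]; but there
    is only one periodic orbit, and it keeps a distance [c] from the origin. *)
Lemma rigid_not_center : ~ is_center V 0.
Proof.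
rewrite /is_center /prop_near1 /dnbhs /within /= => /nbhs_ballP[d /= d0 near_orbit].
have orbit e : 0 < e < d -> exists2 G, periodic_orbit V G & G (e, 0).
  move=> /andP[e0 ed]; apply: near_orbit.
    by split; rewrite /ball /= sub0r normrN ?normr0 // ger0_norm // ltW.
  by apply/eqP => -[/eqP]; rewrite gt_eqF.
have [|G1 oG1 _] := orbit (d / 2); first by apply/andP; split; lra.
have [r [c [C [c0 rb _ G1E]]]] := periodic_orbit_polar _ oG1.
have m0 : 0 < Num.min (d / 2) (c / 2) by rewrite lt_min; apply/andP; split; lra.
have md : Num.min (d / 2) (c / 2) <= d / 2 by rewrite ge_min lexx.
have mc : Num.min (d / 2) (c / 2) <= c / 2 by rewrite ge_min lexx orbT.
have [|G2 oG2] := orbit (Num.min (d / 2) (c / 2)); first by apply/andP; split; lra.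
rewrite (periodic_orbit_subset1 _ _ oG2 oG1) G1E => -[t _ [tx ty]].
have := norm_sqr_polar_curve r t; rewrite /= tx ty expr0n addr0.
have /andP[ct _] := rb t.
have : c ^+ 2 <= r t ^+ 2 by rewrite lerXn2r // nnegrE; lra.
have : Num.min (d / 2) (c / 2) ^+ 2 <= (c / 2) ^+ 2 by rewrite lerXn2r // nnegrE; lra.
have : 0 < c ^+ 2 by exact: exprn_gt0.
rewrite expr_div_n; lra.
Qed.

Lemma rigid_no_periodic_orbit G : (forall t, a t = 0) -> ~ periodic_orbit V G.
Proof.
move=> a0 /periodic_orbit_polar[r [c [C [c0 rb dr _]]]].
exact: (no_bounded_solution k a b b_pi r c C c0 rb dr a0).
Qed.

(** * Existence and instability of the limit cycle *)

Section Existence.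
Variable S : R -> R.
Hypothesis S_prim : forall t, is_derive t 1 S (a t).
Hypothesis S_lt : S (pi *+ 2) < S 0.

Lemma polar_curve_continuous r : continuous r -> continuous (polar_curve r).
Proof.
move=> cr t.
have c1 : (fun s => r s * cos s) @ t --> r t * cos t.
  by apply: cvgM; [exact: cr|exact: continuous_cos].
have c2 : (fun s => r s * sin s) @ t --> r t * sin t.
  by apply: cvgM; [exact: cr|exact: continuous_sin].
exact: cvg_pair c1 c2.
Qed.

Lemma exists_unstable_cycle : exists2 G, unique (limit_cycle V) G &
  unstable_cycle V G.
Proof.
have [r [c [C [c0 rP]]]] := periodic_solution k a b S continuous_a continuous_b
  R3_le0 a_2pi b_2pi S_prim S_lt.
have r_per : periodic r (pi *+ 2) by move=> t; have [] := rP t.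
have rb t : c <= r t <= C by have [] := rP t.
have dr t : is_derive t 1 r (F t (r t)) by have [] := rP t.
have r0 t : 0 < r t by have /andP[+ _] := rb t; exact: lt_le_trans.
have cr : continuous r by move=> t; exact: is_derive_cont (dr t).
pose G := range (polar_curve r).
have oG : periodic_orbit V G.
  exists (polar_curve r), (pi *+ 2); split => //.
  - move=> t _; have := polar_solution r 0 t; rewrite addr0 => /(_ (dr t)).
    by under eq_fun do rewrite addr0.
  - exact: polar_curve_periodic.
  (* The points at angles pi and 0 have first coordinates of opposite signs, so the curve is not
     constant. *)
  - exists pi; apply/eqP => -[/eqP + _]; rewrite cospi cos0 mulrN1 mulr1.
    by rewrite lt_eqF // (lt_trans _ (r0 0)) // oppr_lt0.
have lG : limit_cycle V G.
  split=> //; exists setT => [p _|G' oG' _]; first exact: filterT.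
  exact: periodic_orbit_subset1.
exists G; first by split=> // G' [oG' _]; exact: periodic_orbit_subset1.
have closedG : closed G.
  have -> : G = polar_curve r @` `[0, pi *+ 2].
    apply/seteqP; split=> _ [t _ <-]; last by exists t.
    have [j jt] := periodic_reduce (pi *+ 2) t pi2_gt0.
    exists (t - pi *+ 2 *~ j); first by rewrite /= in_itv.
    by rewrite -(periodicz _ _ (polar_curve_periodic r r_per) j) subrK.
  apply: compact_closed; first exact: norm_hausdorff.
  apply: continuous_compact; last exact: segment_compact.
  exact/continuous_subspaceT/polar_curve_continuous.
(* The whole punctured plane serves as the neighbourhood repelled by the cycle. *)
exists [set p | p != 0].
  move=> _ [t _ <-]; apply: open_nbhs_nbhs; split.
    rewrite -[X in open X]setCK; apply: closed_openC.
    have -> : ~` [set p : R * R | p != 0] = [set 0].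
      by apply/seteqP; split=> p /=; [move/negP; rewrite negbK => /eqP|move=> ->; rewrite eqxx].
    exact/accessible_closed_set1/hausdorff_accessible/norm_hausdorff.
  have := norm_sqr_polar_curve r t; apply: contra_eq_neq => ->.
  by rewrite /= expr0n addr0 eq_sym gt_eqF // exprn_gt0.
move=> p /= p0.
have [x0 [alpha [x00 p1 p2]]] : exists rho alpha,
    [/\ 0 < rho, p.1 = rho * cos alpha & p.2 = rho * sin alpha].
  apply: polar_decomposition.
  rewrite lt_neqAle addr_ge0 ?sqr_ge0 // andbT eq_sym paddr_eq0 ?sqr_ge0 //.
  rewrite !sqrf_eq0; apply: contra p0 => /andP[/eqP p1 /eqP p2].
  by rewrite [p]surjective_pairing p1 p2.
have [u [c' [C' [T [c'0 T0 ux0 uP]]]]] := backward_solution k a b S continuous_a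
  continuous_b R3_le0 a_2pi b_2pi S_prim S_lt alpha x0 x00.
exists (fun t => polar_curve u (t + alpha)), T; split=> //.
- move=> t /= tT; apply: polar_solution.
  by apply: (uP _ _).2; rewrite addrC ltrD2l.
- by rewrite add0r /polar_curve ux0 -p1 -p2 -surjective_pairing.
have m0 : 0 < Num.min c c' by rewrite lt_min c0.
have [D [gam [gam0 H]]] := polar_contraction k a b R3_le0 _ (Num.max C C') m0.
have decay t : t <= 0 -> `|u (t + alpha) - r (t + alpha)| <= D * expR (gam * t).
  move=> t0; have {H} := H r u alpha _ _ (t + alpha) alpha _ (lexx _).
  have -> : - (gam * (alpha - (t + alpha))) = gam * t by ring.
  apply.
  - move=> v _; split=> //; have /andP[v1 v2] := rb v.
    by rewrite ge_min v1 le_max v2.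
  - move=> v va; have [|/andP[v1 v2] ?] := uP v; first by rewrite (le_lt_trans va) // ltrDl.
    by rewrite ge_min v1 le_max v2 !orbT.
  - by rewrite gerDr.
have close e : 0 < e -> exists2 N, N <= 0 & forall t, t < N ->
    ball (polar_curve r (t + alpha)) e (polar_curve u (t + alpha)) /\
    ball (polar_curve u (t + alpha)) e (polar_curve r (t + alpha)).
  move=> e0; pose D1 := Num.max D 0 + 1.
  have DD1 : D <= D1.
    by apply: le_trans (_ : Num.max D 0 <= _); [rewrite le_max lexx|rewrite /D1; lra].
  have D10 : 0 < D1 by rewrite ltr_wpDl // le_max lexx orbT.
  (* Below this time e (1 - gam t) exceeds [D1], and exp(-gam t) >= 1 - gam t makes the decay bound
     smaller than [e]. *)
  exists (- (D1 / (e * gam))) => [|t tN].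
    by rewrite oppr_le0 divr_ge0 // ltW // mulr_gt0.
  have t0 : t <= 0.
    by apply: le_trans (ltW tN) _; rewrite oppr_le0 divr_ge0 // ltW // mulr_gt0.
  have small : `|u (t + alpha) - r (t + alpha)| < e.
    apply: le_lt_trans (decay t t0) _.
    apply: le_lt_trans (_ : D1 * expR (gam * t) < _); first by rewrite ler_wpM2r ?expR_ge0.
    rewrite -[gam * t]opprK expRN ltr_pdivrMr ?expR_gt0 //.
    apply: lt_le_trans (_ : e * (1 + - (gam * t)) <= _); last first.
      by rewrite ler_pM2l // expR_ge1Dx.
    move: tN; rewrite ltrNr ltr_pdivrMr ?mulr_gt0 // => tN.
    have -> : e * (1 + - (gam * t)) = e + - t * (e * gam) by ring.
    lra.
  by split; apply: polar_curve_dist; rewrite // distrC.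
rewrite eqEsubset; split=> q.
  (* A cluster point is approached by the trajectory at times when the latter is already close to
     the closed set [G]. *)
  move=> clq; apply: closedG => B /nbhs_ballP[e /= e0 eB].
  have e2 : 0 < e / 2 by rewrite divr_gt0.
  have [N N0 HN] := close _ e2.
  have [|_ [[t /= tN <-] qt]] := clq [set polar_curve u (t + alpha) | t in [set t | t < N]]
    (ball q (e / 2)) _ (nbhsx_ballx _ _ e2).
    exists N; split; first exact: num_real.
    by move=> t tN; exists t.
  exists (polar_curve r (t + alpha)); split; first by exists (t + alpha).
  apply: eB; rewrite [e]splitr; apply: ball_triangle qt _.
  exact: (HN t tN).2.
move=> [s _ <-] A B [M [_ AM]] /nbhs_ballP[e /= e0 eB].
have [N N0 HN] := close _ e0.
have [t [tM tN tE]] : exists t, [/\ t < M, t < N &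
    polar_curve r (t + alpha) = polar_curve r s].
  (* Going back [j] full turns reaches the given point of the cycle at a time before both [M] and
     [N]. *)
  pose m := Num.min M N; pose j := (Num.trunc ((s - alpha - m) / (pi *+ 2))).+1.
  have jm : s - alpha - m < j%:R * (pi *+ 2) by rewrite -ltr_pdivrMr // truncnS_gt.
  have tm : s - alpha - (pi *+ 2) *+ j < m by rewrite -mulr_natl; lra.
  exists (s - alpha - (pi *+ 2) *+ j); split.
  - by move: tm; rewrite lt_min => /andP[].
  - by move: tm; rewrite lt_min => /andP[].
  - rewrite -[LHS](periodicn (polar_curve_periodic r r_per) j).
    by congr polar_curve; ring.
exists (polar_curve u (t + alpha)); split; first exact: AM.
by apply: eB; rewrite -tE; exact: (HN t tN).1.
Qed.

End Existence.

End RigidSystem.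

Theorem theorem4p1 (R : realType) (n : nat) (hn : (3 <= n)%N) (hodd : odd n)
    (R2 : mpoly2 R) (hR2 : homogeneous n.-2 R2) :
  exists2 delta : R, 0 < delta &
  forall (R1 R3 : mpoly2 R),
    homogeneous n.-1 R1 -> homogeneous (n - 3) R3 ->
    (forall t : R, eval2 R1 (cos t) (sin t) = 1) ->
    (forall t : R, eval2 R3 (cos t) (sin t) <= 0) ->
    let B := \int[lebesgue_measure]_(t in `[0, pi *+ 2]) eval2 R3 (cos t) (sin t) in
    let V := rigid_field (fun x y => eval2 R1 x y + eval2 R2 x y + eval2 R3 x y) in
    [/\ ~ is_center V 0,
        B < 0 -> is_subset1 (limit_cycle V),
        - delta < B -> B < 0 ->
          exists2 G, unique (limit_cycle V) G & unstable_cycle V G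
      & B = 0 -> forall G, ~ limit_cycle V G].
Proof.
exists 1 => // R1 R3.
case: n hn hodd hR2 => [|[|[|k]]] // _ k_odd hom2 hom1.
rewrite !subSS subn0 => hom3 R1_one R3_le0 B V.
have k_even : ~~ odd k by move: k_odd; rewrite /= negbK.
have pi2_gt0 : 0 < pi *+ 2 :> R by rewrite pmulrn_lgt0 // pi_gt0.
have ca : continuous (fun t : R => eval2 R3 (cos t) (sin t)).
  exact: (eval2_continuous _ cos sin (@continuous_cos R) (@continuous_sin R)).
have [S [S0 S_prim]] := continuous_primitive _ ca.
have BE : B = S (pi *+ 2) - S 0 by exact: Rintegral_primitive.
have sub1 := periodic_orbit_subset1 k R1 R2 R3 hom1 hom2 hom3 R1_one R3_le0.
split.
- exact: (rigid_not_center k R1 R2 R3).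
- by move=> _ G1 G2 [oG1 _] [oG2 _]; exact: sub1.
- move=> _ B0; apply: (exists_unstable_cycle k R1 R2 R3) S_prim _ => //.
  by rewrite -subr_lt0 -BE.
(* A nonpositive periodic function with zero integral over a period and a primitive vanishes, which
   leaves the case a = 0. *)
- move=> B0 G [oG _]; apply: (rigid_no_periodic_orbit k R1 R2 R3) oG => //.
  apply: (le0_periodic_primitive _ S (pi *+ 2)) => //.
    by move=> t; rewrite cosD2pi sinD2pi.
  by apply/eqP; rewrite -subr_eq0 -BE B0.
Qed.
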